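(* Let $A$ be a unital commutative $C^*$-algebra carrying a (pointwise continuous) action of $S^1$ by automorphisms such that $E:=A^{(1)}$ generates $A$ as a $C^*$-algebra and $E$ is a finitely generated projective module over $B:=A^{(0)}$. Then: (i) $B=C(X)$ for some compact space $X$; (ii) $E$ is the module of sections of some line bundle $\mathcal L\to X$; (iii) $A$ is isomorphic to $C(P)$, where $P\to X$ is the principal $S^1$-bundle over $X$ associated to $\mathcal L$, and the given $S^1$-action on $A$ comes from the principal $S^1$-action on $P$.
   Context: For an $S^1$-action $\gamma$ on $A$ (the gauge action), the spectral subspaces are $A^{(k)}=\{a\in A:\gamma_z(a)=z^ka\ \text{for all } z\in S^1\subset\mathbb C\}$, $k\in\mathbb Z$. $A^{(0)}$ is a $C^*$-subalgebra and each $A^{(k)}$ is a bimodule over $A^{(0)}$ under multiplication. Line bundles are complex and locally trivial; the line bundle in question is Hermitian with scalar product $\langle\xi,\eta\rangle=\xi^*\eta$. *)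

(* Defs.v *)
From HB Require Import structures.
From mathcomp Require Import all_boot all_order all_algebra complex.
From mathcomp Require Import all_classical all_reals topology normedtype.

Set Implicit Arguments.
Unset Strict Implicit.
Unset Printing Implicit Defensive.

Import Order.TTheory GRing.Theory Num.Theory.
Import numFieldTopology.Exports numFieldNormedType.Exports.

Local Open Scope classical_set_scope.
Local Open Scope ring_scope.

(* Everything is set up over an arbitrary [C : numClosedFieldType] with the
   topology of its norm; the intended instance is [R[i]], [R : realType]. *)

(* Unital commutative *-algebras. The product is part of the mixin because
   Hierarchy Builder cannot join the library's rings with its normed modules
   once numDomainType is declared. The zero algebra is allowed. *)
HB.mixin Record isComStarAlgebra (C : numClosedFieldType) A
    of GRing.Lmodule C A := {
  aone : A;
  amul : A -> A -> A;
  star : A -> A;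
  amulA : associative amul;
  amulC : commutative amul;
  amul1 : left_id aone amul;
  amulDl : left_distributive amul +%R;
  amulZl : forall (k : C) (a b : A), amul (k *: a) b = k *: amul a b;
  starK : involutive star;
  starD : {morph star : a b / a + b};
  starZ : forall (k : C) (a : A), star (k *: a) = k^* *: star a;
  starM : forall a b : A, star (amul a b) = amul (star b) (star a)
}.

#[short(type="comStarAlgType")]
HB.structure Definition ComStarAlgebra (C : numClosedFieldType) :=
  {A of GRing.Lmodule C A & isComStarAlgebra C A}.

Arguments aone {C A} : rename.

HB.mixin Record ComStarAlgebra_isCStar (C : numClosedFieldType) A
    of CompleteNormedModule C A & ComStarAlgebra C A := {
  norm_amul : forall a b : A, `|amul a b| <= `|a| * `|b|;
  cstar_identity : forall a : A, `|amul (star a) a| = `|a| ^+ 2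
}.

#[short(type="comCStarAlgType")]
HB.structure Definition ComCStarAlgebra (C : numClosedFieldType) :=
  {A of CompleteNormedModule C A & ComStarAlgebra C A
      & ComStarAlgebra_isCStar C A}.

Definition star_isomorphism (C : numClosedFieldType) (A B : comStarAlgType C)
    (f : A -> B) : Prop :=
  [/\ bijective f, linear f, f aone = aone, {morph f : a b / amul a b}
    & {morph f : a / star a}].

(* A C*-subalgebra need not contain the unit of the ambient algebra, so
   [cstar_generated S] is the smallest, possibly non-unital, C*-subalgebra
   containing [S]. *)
Definition cstar_subalgebra (C : numClosedFieldType) (A : comCStarAlgType C)
    (S : set A) : Prop :=
  [/\ S 0,
      forall (k : C) a b, S a -> S b -> S (k *: a + b),
      forall a b, S a -> S b -> S (amul a b),
      forall a, S a -> S (star a)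
    & closed S].

Definition cstar_generated (C : numClosedFieldType) (A : comCStarAlgType C)
    (S : set A) : set A :=
  smallest (@cstar_subalgebra C A) S.

Section ContinuousFunctions.
Variables (C : numClosedFieldType) (X : topologicalType).

Definition cfun := continuousType X C.

HB.instance Definition _ := Choice.copy cfun (continuousType X C).

Definition cfun_val (f : cfun) : X -> C := f.

Lemma cfunP (f g : cfun) : cfun_val f =1 cfun_val g -> f = g.
Proof. by move=> fg; apply/continuousEP. Qed.

Lemma cfun_continuous (f : cfun) : continuous (cfun_val f).
Proof. exact: (@cts_fun _ _ f). Qed.

Definition mk_cfun (f : X -> C) (cf : continuous f) : cfun := mkcts cf.

Fact cfun_cst_subproof (k : C) : continuous (fun _ : X => k).
Proof. by move=> x; exact: cvg_cst. Qed.

Fact cfun_add_subproof (f g : cfun) :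
  continuous (fun x => cfun_val f x + cfun_val g x).
Proof. by move=> x; apply: cvgD; apply: cfun_continuous. Qed.

Fact cfun_opp_subproof (f : cfun) : continuous (fun x => - cfun_val f x).
Proof. by move=> x; apply: cvgN; apply: cfun_continuous. Qed.

Fact cfun_mul_subproof (f g : cfun) :
  continuous (fun x => cfun_val f x * cfun_val g x).
Proof. by move=> x; apply: cvgM; apply: cfun_continuous. Qed.

Fact cfun_scale_subproof (k : C) (f : cfun) :
  continuous (fun x => k * cfun_val f x).
Proof. by move=> x; apply: cvgM; [exact: cvg_cst|exact: cfun_continuous]. Qed.

Fact cfun_conj_subproof (f : cfun) : continuous (fun x => (cfun_val f x)^*).
Proof.
move=> x; apply/cvgrPdist_lt => e e0.
move/cvgrPdist_lt: (cfun_continuous (f := f) (x := x)) => /(_ e e0).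
by apply: filterS => y; rewrite -rmorphB norm_conjC.
Qed.

Definition cfun_cst k := mk_cfun (@cfun_cst_subproof k).
Definition cfun_add f g := mk_cfun (@cfun_add_subproof f g).
Definition cfun_opp f := mk_cfun (@cfun_opp_subproof f).
Definition cfun_mul f g := mk_cfun (@cfun_mul_subproof f g).
Definition cfun_scale k f := mk_cfun (@cfun_scale_subproof k f).
Definition cfun_conj f := mk_cfun (@cfun_conj_subproof f).

Fact cfun_addA : associative cfun_add.
Proof. by move=> f g h; apply: cfunP => x; exact: addrA. Qed.
Fact cfun_addC : commutative cfun_add.
Proof. by move=> f g; apply: cfunP => x; exact: addrC. Qed.
Fact cfun_add0 : left_id (cfun_cst 0) cfun_add.
Proof. by move=> f; apply: cfunP => x; exact: add0r. Qed.
Fact cfun_addN : left_inverse (cfun_cst 0) cfun_opp cfun_add.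
Proof. by move=> f; apply: cfunP => x; exact: addNr. Qed.

HB.instance Definition _ :=
  GRing.isZmodule.Build cfun cfun_addA cfun_addC cfun_add0 cfun_addN.

Fact cfun_scaleA a b v : cfun_scale a (cfun_scale b v) = cfun_scale (a * b) v.
Proof. by apply: cfunP => x; exact: mulrA. Qed.
Fact cfun_scale1 : left_id 1 cfun_scale.
Proof. by move=> f; apply: cfunP => x; exact: mul1r. Qed.
Fact cfun_scaleDr : right_distributive cfun_scale +%R.
Proof. by move=> k f g; apply: cfunP => x; exact: mulrDr. Qed.
Fact cfun_scaleDl v : {morph cfun_scale^~ v : a b / a + b}.
Proof. by move=> a b; apply: cfunP => x; exact: mulrDl. Qed.

HB.instance Definition _ := GRing.Zmodule_isLmodule.Build C cfun
  cfun_scaleA cfun_scale1 cfun_scaleDr cfun_scaleDl.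

Fact cfun_mulA : associative cfun_mul.
Proof. by move=> f g h; apply: cfunP => x; exact: mulrA. Qed.
Fact cfun_mulC : commutative cfun_mul.
Proof. by move=> f g; apply: cfunP => x; exact: mulrC. Qed.
Fact cfun_mul1 : left_id (cfun_cst 1) cfun_mul.
Proof. by move=> f; apply: cfunP => x; exact: mul1r. Qed.
Fact cfun_mulDl : left_distributive cfun_mul +%R.
Proof. by move=> f g h; apply: cfunP => x; exact: mulrDl. Qed.
Fact cfun_mulZl (k : C) (f g : cfun) :
  cfun_mul (k *: f) g = k *: cfun_mul f g.
Proof. by apply: cfunP => x; symmetry; exact: mulrA. Qed.
Fact cfun_conjK : involutive cfun_conj.
Proof. by move=> f; apply: cfunP => x; exact: conjCK. Qed.
Fact cfun_conjD : {morph cfun_conj : f g / f + g}.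
Proof. by move=> f g; apply: cfunP => x; exact: rmorphD. Qed.
Fact cfun_conjZ (k : C) (f : cfun) : cfun_conj (k *: f) = k^* *: cfun_conj f.
Proof. by apply: cfunP => x; exact: rmorphM. Qed.
Fact cfun_conjM f g :
  cfun_conj (cfun_mul f g) = cfun_mul (cfun_conj g) (cfun_conj f).
Proof. by rewrite cfun_mulC; apply: cfunP => x; exact: rmorphM. Qed.

HB.instance Definition _ := isComStarAlgebra.Build C cfun
  cfun_mulA cfun_mulC cfun_mul1 cfun_mulDl cfun_mulZl
  cfun_conjK cfun_conjD cfun_conjZ cfun_conjM.

End ContinuousFunctions.

Coercion cfun_val : cfun >-> Funclass.

Section Circle.
Variable C : numClosedFieldType.

Definition circle := set_type [set z : C | `|z| = 1].

HB.instance Definition _ := Topological.on circle.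

Lemma circle_norm (z : circle) : `|\val z| = 1.
Proof. exact: (set_mem (valP z)). Qed.

Definition mk_circle (z : C) (hz : `|z| = 1) : circle :=
  exist _ z (mem_set hz).

Lemma circle_neq0 (z : circle) : \val z != 0.
Proof. by rewrite -normr_eq0 circle_norm oner_neq0. Qed.

Fact circle_one_subproof : `|1 : C| = 1.
Proof. exact: normr1. Qed.

Fact circle_mul_subproof (z w : circle) : `|\val z * \val w| = 1.
Proof. by rewrite normrM !circle_norm mulr1. Qed.

Fact circle_inv_subproof (z : circle) : `|(\val z)^-1| = 1.
Proof. by rewrite normfV circle_norm invr1. Qed.

Definition circle_one := mk_circle circle_one_subproof.
Definition circle_mul z w := mk_circle (circle_mul_subproof z w).
Definition circle_inv z := mk_circle (circle_inv_subproof z).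

Fact circle_mulA : associative circle_mul.
Proof. by move=> x y z; apply: val_inj; rewrite /= mulrA. Qed.

Fact circle_mul1 : left_id circle_one circle_mul.
Proof. by move=> x; apply: val_inj; rewrite /= mul1r. Qed.

Fact circle_mul1r : right_id circle_one circle_mul.
Proof. by move=> x; apply: val_inj; rewrite /= mulr1. Qed.

Fact circle_mulV : left_inverse circle_one circle_inv circle_mul.
Proof. by move=> x; apply: val_inj; rewrite /= mulVf ?circle_neq0. Qed.

Fact circle_mulVr : right_inverse circle_one circle_inv circle_mul.
Proof. by move=> x; apply: val_inj; rewrite /= mulfV ?circle_neq0. Qed.

HB.instance Definition _ := isGroup.Build circle
  circle_mulA circle_mul1 circle_mul1r circle_mulV circle_mulVr.

End Circle.

Record circle_action (C : numClosedFieldType) (A : comCStarAlgType C) :=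
  CircleAction {
    gauge :> circle C -> A -> A;
    gauge_aut : forall z, star_isomorphism (gauge z);
    gauge1 : forall a, gauge 1%g a = a;
    gaugeM : forall z w a, gauge (z * w)%g a = gauge z (gauge w a);
    gauge_continuous : forall a, continuous (fun z => gauge z a)
  }.

Section Spectral.
Variables (C : numClosedFieldType) (A : comCStarAlgType C).
Variable gamma : circle_action A.

Definition spectral_subspace (k : int) : set A :=
  [set a | forall z : circle C, gamma z a = (\val z ^ k) *: a].

Lemma gauge_lin z : linear (gamma z).
Proof. by case: (gauge_aut gamma z). Qed.

Lemma gauge_amul z : {morph gamma z : a b / amul a b}.
Proof. by case: (gauge_aut gamma z). Qed.

Lemma gauge_aone z : gamma z aone = aone.
Proof. by case: (gauge_aut gamma z). Qed.

Lemma gauge_star z : {morph gamma z : a / star a}.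
Proof. by case: (gauge_aut gamma z). Qed.

Lemma gauge_0 z : gamma z 0 = 0.
Proof. by have := gauge_lin z (-1) 0 0; rewrite !scaleN1r !addNr. Qed.

Lemma spectral_lin (m : int) (k : C) a b : spectral_subspace m a ->
  spectral_subspace m b -> spectral_subspace m (k *: a + b).
Proof.
by move=> ha hb z; rewrite gauge_lin ha hb scalerDr !scalerA mulrC.
Qed.

Lemma spectral0 m : spectral_subspace m 0.
Proof. by move=> z; rewrite gauge_0 scaler0. Qed.

Lemma spectralZ m (k : C) a :
  spectral_subspace m a -> spectral_subspace m (k *: a).
Proof.
move=> ha; rewrite -[k *: a]addr0; apply: spectral_lin => //.
exact: spectral0.
Qed.

Lemma spectralD m a b : spectral_subspace m a -> spectral_subspace m b ->
  spectral_subspace m (a + b).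
Proof. by move=> ha hb; rewrite -[a]scale1r; exact: spectral_lin. Qed.

Lemma amulZr (k : C) (a b : A) : amul a (k *: b) = k *: amul a b.
Proof. by rewrite amulC amulZl amulC. Qed.

Lemma amulDr (a b c : A) : amul a (b + c) = amul a b + amul a c.
Proof. by rewrite amulC amulDl ![amul _ a]amulC. Qed.

Lemma spectralM m n a b : spectral_subspace m a -> spectral_subspace n b ->
  spectral_subspace (m + n) (amul a b).
Proof.
move=> ha hb z; rewrite gauge_amul ha hb amulZl amulZr scalerA.
by rewrite expfzDr ?circle_neq0.
Qed.

Lemma spectral1 : spectral_subspace 0 aone.
Proof. by move=> z; rewrite gauge_aone expr0z scale1r. Qed.

Lemma spectral_star m a :
  spectral_subspace m a -> spectral_subspace (- m) (star a).
Proof.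
move=> ha z; rewrite gauge_star ha starZ; congr (_ *: _).
rewrite fmorphXz /= -exprz_inv; congr (_ ^ _).
apply: (mulfI (circle_neq0 z)).
by rewrite -normCK circle_norm expr1n mulfV ?circle_neq0.
Qed.

Fact spectral_submod m :
  subsemimod_closed (fun a : A => a \in spectral_subspace m).
Proof.
split; first split.
- exact/mem_set/spectral0.
- by move=> a b /set_mem ha /set_mem hb; exact/mem_set/spectralD.
- by move=> k a /set_mem ha; exact/mem_set/spectralZ.
Qed.

Definition gauge_base := set_type (spectral_subspace 0).
Definition gauge_module := set_type (spectral_subspace 1).

HB.instance Definition _ := SubChoice.on gauge_base.
HB.instance Definition _ := SubChoice.on gauge_module.

HB.instance Definition _ :=
  GRing.SubChoice_isSubLmodule.Build C A _ gauge_base (spectral_submod 0).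

Fact spectral_zmod m : zmod_closed (fun a : A => a \in spectral_subspace m).
Proof.
split; first exact/mem_set/spectral0.
move=> a b /set_mem ha /set_mem hb; apply/mem_set.
by rewrite -scaleN1r; apply: spectralD => //; exact: spectralZ.
Qed.

HB.instance Definition _ :=
  GRing.SubChoice_isSubZmodule.Build A _ gauge_module (spectral_zmod 1).

Definition mk_base (a : A) (ha : spectral_subspace 0 a) : gauge_base :=
  exist _ a (mem_set ha).

Definition mk_module (a : A) (ha : spectral_subspace 1 a) : gauge_module :=
  exist _ a (mem_set ha).

Lemma gauge_baseP (b : gauge_base) : spectral_subspace 0 (\val b).
Proof. exact: (set_mem (valP b)). Qed.

Lemma gauge_moduleP (e : gauge_module) : spectral_subspace 1 (\val e).
Proof. exact: (set_mem (valP e)). Qed.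

Fact base_mul_subproof (a b : gauge_base) :
  spectral_subspace 0 (amul (\val a) (\val b)).
Proof. exact: (spectralM (gauge_baseP a) (gauge_baseP b)). Qed.

Fact base_star_subproof (a : gauge_base) : spectral_subspace 0 (star (\val a)).
Proof. exact: (spectral_star (gauge_baseP a)). Qed.

Fact module_scale_subproof (b : gauge_base) (e : gauge_module) :
  spectral_subspace 1 (amul (\val b) (\val e)).
Proof. exact: (spectralM (gauge_baseP b) (gauge_moduleP e)). Qed.

Fact gauge_dot_subproof (xi eta : gauge_module) :
  spectral_subspace 0 (amul (star (\val xi)) (\val eta)).
Proof.
exact: (spectralM (spectral_star (gauge_moduleP xi)) (gauge_moduleP eta)).
Qed.

Definition base_one := mk_base spectral1.
Definition base_mul a b := mk_base (base_mul_subproof a b).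
Definition base_star a := mk_base (base_star_subproof a).
Definition module_scale b e := mk_module (module_scale_subproof b e).
Definition gauge_dot xi eta := mk_base (gauge_dot_subproof xi eta).

Fact base_mulA : associative base_mul.
Proof. by move=> a b c; apply: val_inj; exact: amulA. Qed.
Fact base_mulC : commutative base_mul.
Proof. by move=> a b; apply: val_inj; exact: amulC. Qed.
Fact base_mul1 : left_id base_one base_mul.
Proof. by move=> a; apply: val_inj; exact: amul1. Qed.
Fact base_mulDl : left_distributive base_mul +%R.
Proof. by move=> a b c; apply: val_inj; exact: amulDl. Qed.
Fact base_mulZl (k : C) (a b : gauge_base) :
  base_mul (k *: a) b = k *: base_mul a b.
Proof. by apply: val_inj; exact: amulZl. Qed.
Fact base_starK : involutive base_star.
Proof. by move=> a; apply: val_inj; exact: starK. Qed.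
Fact base_starD : {morph base_star : a b / a + b}.
Proof. by move=> a b; apply: val_inj; exact: starD. Qed.
Fact base_starZ (k : C) (a : gauge_base) :
  base_star (k *: a) = k^* *: base_star a.
Proof. by apply: val_inj; exact: starZ. Qed.
Fact base_starM a b :
  base_star (base_mul a b) = base_mul (base_star b) (base_star a).
Proof. by apply: val_inj; exact: starM. Qed.

HB.instance Definition _ := isComStarAlgebra.Build C gauge_base
  base_mulA base_mulC base_mul1 base_mulDl base_mulZl
  base_starK base_starD base_starZ base_starM.

(* Same product as above, so that [gauge_module] is a library module over
   [gauge_base]. *)
HB.instance Definition _ := GRing.Zmodule_isComPzRing.Build gauge_base
  base_mulA base_mulC base_mul1 base_mulDl.

Fact module_scaleA a b e :
  module_scale a (module_scale b e) = module_scale (a * b) e.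
Proof. by apply: val_inj; exact: amulA. Qed.
Fact module_scale1 : left_id 1 module_scale.
Proof. by move=> e; apply: val_inj; exact: amul1. Qed.
Fact module_scaleDr : right_distributive module_scale +%R.
Proof. by move=> a e f; apply: val_inj; exact: amulDr. Qed.
Fact module_scaleDl e : {morph module_scale^~ e : a b / a + b}.
Proof. by move=> a b; apply: val_inj; exact: amulDl. Qed.

HB.instance Definition _ := GRing.Zmodule_isLmodule.Build gauge_base
  gauge_module module_scaleA module_scale1 module_scaleDr module_scaleDl.

End Spectral.

Definition finitely_generated (B : pzRingType) (M : lmodType B) : Prop :=
  exists (n : nat) (g : 'I_n -> M),
    forall m : M, exists c : 'I_n -> B, m = \sum_i c i *: g i.

Definition projective (B : pzRingType) (M : lmodType B) : Prop :=
  forall (N N' : lmodType B) (p : {linear N -> N'}) (f : {linear M -> N'}),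
    (forall y, exists x, p x = y) ->
    exists g : {linear M -> N}, forall m, p (g m) = f m.

(* [f] restricts to a homeomorphism from [A] onto [B]. *)
Definition homeomorphism_on (S T : topologicalType) (A : set S) (B : set T)
    (f : S -> T) : Prop :=
  {within A, continuous f} /\
  exists g : T -> S,
    [/\ {within B, continuous g}, set_fun A B f, set_fun B A g,
        {in A, cancel f g} & {in B, cancel g f}].

Section LineBundle.
Variables (C : numClosedFieldType) (X : topologicalType).

(* A family of vector spaces over [X]; the topology of its total space is a
   field, as the one found by inference on a sigma type is the disjoint union
   topology. *)
Record vector_family := VectorFamily {
  fiber : X -> lmodType C;
  total_class : Topological.axioms_ {x : X & fiber x}
}.

Definition total_space (L : vector_family) : topologicalType :=
  Topological.Pack (total_class L).

Definition total_pt (L : vector_family) (x : X) (v : fiber L x) :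
  total_space L := existT (fiber L) x v.

Definition bundle_proj (L : vector_family) (p : total_space L) : X := projT1 p.

Definition bundle_vec (L : vector_family) (p : total_space L) :
  fiber L (bundle_proj p) := projT2 p.

(* That the fibres are one-dimensional is part of local triviality. *)
Record line_bundle := LineBundle {
  line_family :> vector_family;
  bundle_proj_continuous : continuous (@bundle_proj line_family);
  line_locally_trivial : forall x : X, exists2 U : set X, open_nbhs x U &
    exists h : forall y, fiber line_family y -> C,
      (forall y, U y -> scalar (h y)) /\
      homeomorphism_on (@bundle_proj line_family @^-1` U) (U `*` setT)
        (fun p => (bundle_proj p, h (bundle_proj p) (bundle_vec p)))
}.

(* The fibre product of the total space with itself over [X]. *)
Definition fiber_square (L : line_bundle) :=
  {x : X & (fiber L x * fiber L x)%type}.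

Definition fiber_square_incl (L : line_bundle) (w : fiber_square L) :
    (total_space L * total_space L)%type :=
  (total_pt (projT2 w).1, total_pt (projT2 w).2).

(* Scalar products are antilinear in the first variable. *)
Record hermitian_line_bundle := HermitianLineBundle {
  herm_line :> line_bundle;
  hdot : forall x, fiber herm_line x -> fiber herm_line x -> C;
  hdot_linear : forall x (u : fiber herm_line x), scalar (hdot u);
  hdot_conj : forall x (u v : fiber herm_line x), hdot v u = (hdot u v)^*;
  hdot_gt0 : forall x (u : fiber herm_line x), u != 0 -> 0 < hdot u u;
  hdot_continuous :
    continuous ((fun w => hdot (projT2 w).1 (projT2 w).2) :
      initial_topology (@fiber_square_incl herm_line) -> C)
}.

Definition continuous_sections (L : line_bundle) :
    set (forall x, fiber L x) :=
  [set s | continuous (fun x => total_pt (s x))].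

Variable L : hermitian_line_bundle.

(* The principal bundle associated to [L], as its unit circle bundle with
   scalar multiplication as action. A section [s] of [L] corresponds to the
   function [p |-> hdot p s], which is multiplied by [z] when [p] is replaced
   by [z^-1 p]. *)
Definition circle_bundle := set_type
  [set p : total_space L | hdot (bundle_vec p) (bundle_vec p) = 1].

HB.instance Definition _ := Topological.on circle_bundle.

Definition circle_bundle_proj (p : circle_bundle) : X := bundle_proj (\val p).

Definition circle_bundle_vec (p : circle_bundle) :
  fiber L (circle_bundle_proj p) := bundle_vec (\val p).

Fact circle_bundle_act_subproof (z : circle C) (p : circle_bundle) :
  hdot (\val z *: circle_bundle_vec p) (\val z *: circle_bundle_vec p) = 1.
Proof.
have hZ x (k : C) (u v : fiber L x) : hdot u (k *: v) = k * hdot u v.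
  have h0 : hdot u 0 = 0.
    by have := hdot_linear u (-1) 0 0; rewrite scaleN1r addNr mulN1r addNr.
  by have := hdot_linear u k v 0; rewrite !addr0 h0 addr0.
have h1 : hdot (circle_bundle_vec p) (circle_bundle_vec p) = 1.
  exact: (set_mem (valP p)).
by rewrite hZ hdot_conj hZ h1 mulr1 -normCK circle_norm expr1n.
Qed.

Definition circle_bundle_act (z : circle C) (p : circle_bundle) :
    circle_bundle :=
  exist _ (total_pt (\val z *: circle_bundle_vec p))
    (mem_set (circle_bundle_act_subproof z p)).

End LineBundle.

Arguments continuous_sections {C X} L _.
Arguments circle_bundle_proj {C X} L p.
Arguments circle_bundle_act {C X} L z p.

Definition principal_circle_bundle (C : numClosedFieldType)
    (P X : topologicalType) (pi : P -> X) (act : circle C -> P -> P) : Prop :=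
  [/\ continuous pi,
      continuous (fun zp : circle C * P => act zp.1 zp.2),
      forall p, act 1%g p = p,
      (forall z w p, act (z * w)%g p = act z (act w p)) /\
      (forall z p, pi (act z p) = pi p)
    & forall x : X, exists2 U : set X, open_nbhs x U &
        exists2 h : P -> circle C,
          homeomorphism_on (pi @^-1` U) (U `*` setT) (fun p => (pi p, h p)) &
          forall z p, U (pi p) -> h (act z p) = (z * h p)%g].

(* Main.v *)
From HB Require Import structures.
Require Import Defs.
From mathcomp Require Import all_boot all_order all_algebra complex.
From mathcomp Require Import all_classical all_reals topology normedtype.
From mathcomp Require Import sequences derive.
From mathcomp Require Import ring lra.

Set Implicit Arguments.
Unset Strict Implicit.
Unset Printing Implicit Defensive.

Import Order.TTheory GRing.Theory Num.Theory.
Import numFieldNormedType.Exports.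

Local Open Scope classical_set_scope.
Local Open Scope ring_scope.

(** The algebra is represented on its own characters, and the circle acts there.

Characters. In a commutative C*-algebra the norm q satisfies
q(a a) = q(a)^2. For a unital seminorm q with this property and q(b) > 0,
q_b(a) = inf_n q(a b^n) / q(b)^n has the property again, lies below q, and
satisfies q_b(a b) = q(b) q_b(a). A seminorm that is minimal among these (Zorn)
equals all its localizations q_b, so it is multiplicative; beginning with the
localization of the norm at a0 keeps the value at a0
([exists_multiplicative_seminorm]). Ostrowski's argument then gives, for a
multiplicative seminorm q and an element x, a scalar z with q(x - z) = 0
([exists_residue]), and x |-> z is a character. So for each a0 some character
attains the norm of a0 in modulus ([exists_character]).

Gelfand duality. The spectrum is compact by Tychonoff's theorem, and its
topology is generated by the transforms chi |-> chi(a); a Stone-Weierstrass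
argument and the completeness of A show that every continuous function on the
spectrum is such a transform ([gelfand_surjective]).

Geometry. Let B and E be the spectral subspaces of degrees 0 and 1, and let X
be the space of restrictions to B of characters of A. The set of elements
killed by a character, and the set on which two characters agree, are
C*-subalgebras; as E generates A, no character vanishes on E and a character is
determined by its values on E. If chi and psi agree on B then the conjugate of
chi(xi) times chi(eta) equals the same expression for psi, for xi and eta in E,
so chi and psi differ on E by a scalar of modulus one, that is, by a rotation.
Hence the spectrum is a free circle space whose orbits are the points of X.

Choose a character p_x over each x in X. The line bundle has fibre C over x, an
element v of modulus one standing for the rotated character v.p_x, and its
total space carries the coarsest topology for which x and all the products of v
with the conjugate of p_x(xi), xi in E, are continuous; another choice of the
p_x gives an isomorphic bundle. The element xi of E becomes the section x |-> p_x(xi).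
The circle bundle of this line bundle is the spectrum, so the three assertions
are Gelfand duality for all continuous functions on the spectrum (giving A), for
the invariant ones (giving B), and for the equivariant ones of degree one, which
are the sections of the line bundle (giving E). *)

(** * Norms with real values *)

(** Norms over R[i] are elements of R[i]; infima and minima need them in R. *)
Definition rnorm (R : realType) (V : normedZmodType R[i]) (v : V) : R :=
  complex.Re `|v|.

Section RNorm.
Local Open Scope complex_scope.
Variables (R : realType).

Lemma rnormE (V : normedZmodType R[i]) (v : V) : `|v| = (rnorm v)%:C.
Proof. by rewrite /rnorm RRe_real // ger0_real. Qed.

Lemma rnorm_ge0 (V : normedZmodType R[i]) (v : V) : 0 <= rnorm v.
Proof. by rewrite -ler0c -rnormE. Qed.

Lemma ler_rnormD (V : normedZmodType R[i]) (u v : V) :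
  rnorm (u + v) <= rnorm u + rnorm v.
Proof. by rewrite -lecR rmorphD /= -!rnormE ler_normD. Qed.

Lemma rnormZ (V : normedModType R[i]) k (v : V) :
  rnorm (k *: v) = rnorm k * rnorm v.
Proof. by apply: complexI; rewrite rmorphM /= -!rnormE normrZ. Qed.

Lemma rnormM (k l : R[i]) : rnorm (k * l) = rnorm k * rnorm l.
Proof. by apply: complexI; rewrite rmorphM /= -!rnormE normrM. Qed.

Lemma rnormN (V : normedZmodType R[i]) (v : V) : rnorm (- v) = rnorm v.
Proof. by rewrite /rnorm normrN. Qed.

Lemma rnorm0_eq0 (V : normedZmodType R[i]) (v : V) : rnorm v = 0 -> v = 0.
Proof. by move=> v0; apply/normr0_eq0; rewrite rnormE v0. Qed.

Lemma rnorm1 : rnorm (1 : R[i]) = 1.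
Proof. by rewrite /rnorm normr1. Qed.

Lemma rnorm0 (V : normedZmodType R[i]) : rnorm (0 : V) = 0.
Proof. by rewrite /rnorm normr0. Qed.

Lemma rnorm_real (x : R) : rnorm x%:C = `|x|.
Proof.
by rewrite /rnorm normc_def /= expr0n addr0 sqrtr_sqr.
Qed.

End RNorm.

(** * Infima of seminorms *)
Section DirectedInfimum.
Variables (R : realType) (T : Type) (D : set (T -> R)).
Hypothesis D0 : D !=set0.
Hypothesis Dge0 : forall f, D f -> forall t, 0 <= f t.

Definition pinf (t : T) : R := inf [set f t | f in D].

Lemma pinf_has t : has_inf [set f t | f in D].
Proof.
split; first by case: D0 => f Df; exists (f t), f.
by exists 0 => _ [f Df <-]; exact: Dge0.
Qed.

Lemma pinf_le f t : D f -> pinf t <= f t.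
Proof.
move=> Df; apply: ge_inf; last by exists f.
by case: (pinf_has t).
Qed.

Lemma le_pinf c t : (forall f, D f -> c <= f t) -> c <= pinf t.
Proof.
move=> h; apply: lb_le_inf; first by case: (pinf_has t).
by move=> _ [f Df <-]; exact: h.
Qed.

Lemma pinf_ge0 t : 0 <= pinf t.
Proof. by apply: le_pinf => f Df; exact: Dge0. Qed.

Lemma le_pinfM c k t : 0 <= k -> (forall f, D f -> c <= f t * k) ->
  c <= pinf t * k.
Proof.
rewrite le_eqVlt => /orP[/eqP <- h|k0 h].
  by case: D0 => f Df; have := h f Df; rewrite !mulr0.
rewrite -ler_pdivrMr //; apply: le_pinf => f Df.
by rewrite ler_pdivrMr //; exact: h.
Qed.

Lemma le_pinfD c s t : (forall f g, D f -> D g -> c <= f s + g t) ->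
  c <= pinf s + pinf t.
Proof.
move=> h; rewrite -lerBlDr; apply: le_pinf => f Df.
rewrite lerBlDr -lerBlDl; apply: le_pinf => g Dg.
by rewrite lerBlDl; exact: h.
Qed.

Lemma le_pinfMM c s t : (forall f g, D f -> D g -> c <= f s * g t) ->
  c <= pinf s * pinf t.
Proof.
move=> h; apply: le_pinfM; first exact: pinf_ge0.
move=> f Df; rewrite mulrC; apply: le_pinfM; first exact: Dge0.
by move=> g Dg; rewrite mulrC; exact: h.
Qed.

End DirectedInfimum.

Section Seminorms.
Variables (R : realType) (A : comStarAlgType R[i]).
Implicit Types (q : A -> R) (a b c : A).

Lemma amulr1 a : amul a aone = a.
Proof. by rewrite amulC amul1. Qed.

Lemma amulACA a b c (d : A) :
  amul (amul a b) (amul c d) = amul (amul a c) (amul b d).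
Proof. by rewrite -!amulA; congr amul; rewrite !amulA (amulC b). Qed.

Definition unital_seminorm q :=
  [/\ forall a b, q (a + b) <= q a + q b,
      forall k a, q (k *: a) = rnorm k * q a
    & q aone = 1].

Lemma unital_seminorm_ge0 q a : unital_seminorm q -> 0 <= q a.
Proof.
move=> [qD qZ _]; have := qD a (- a); rewrite subrr -{1}(scale0r a) qZ rnorm0.
by rewrite -scaleN1r qZ rnormN rnorm1 mul0r mul1r -mulr2n pmulrn_lge0.
Qed.

(** What the C*-identity gives in the commutative case ([rnorm_square_seminorm]), in a
    form that localization inherits. *)
Definition square_seminorm q :=
  [/\ unital_seminorm q, forall a b, q (amul a b) <= q a * q b
    & forall a, q (amul a a) = q a * q a].

(** Directedness lets one member of the family bound two others at once, so
    inequalities between finitely many values pass to the infimum. The last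
    two conditions ask less than multiplicativity of the members: they hold
    for the quotients q(a b^n) / q(b)^n, which are submultiplicative only after
    their indices are added. *)
Lemma pinf_square_seminorm (D : set (A -> R)) : D !=set0 ->
  (forall f, D f -> unital_seminorm f) ->
  (forall f g, D f -> D g ->
     exists2 h, D h & forall a, h a <= f a /\ h a <= g a) ->
  (forall f g, D f -> D g ->
     exists2 h, D h & forall a b, h (amul a b) <= f a * g b) ->
  (forall f a, D f -> f a * f a <= f (amul a a)) ->
  square_seminorm (pinf D).
Proof.
move=> D0 Dsn Ddir DM Dsq.
have Dge0 f : D f -> forall a, 0 <= f a.
  by move=> /Dsn fsn a; exact: unital_seminorm_ge0.
have pM a b : pinf D (amul a b) <= pinf D a * pinf D b.
  apply: le_pinfMM => // f g Df Dg; have [h Dh hM] := DM _ _ Df Dg.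
  by apply: le_trans (hM a b); exact: pinf_le.
split=> //; first split.
- move=> a b; apply: le_pinfD => // f g Df Dg.
  have [h Dh hle] := Ddir _ _ Df Dg.
  apply: (le_trans (pinf_le D0 Dge0 _ Dh)).
  have [hD _ _] := Dsn _ Dh; apply: le_trans (hD a b) _.
  by apply: lerD; case: (hle a); case: (hle b).
- move=> k a; apply/eqP; rewrite eq_le; apply/andP; split.
    rewrite mulrC; apply: le_pinfM => //; first exact: rnorm_ge0.
    by move=> f Df; have [_ fZ _] := Dsn _ Df; rewrite mulrC -fZ pinf_le.
  apply: le_pinf => // f Df; have [_ -> _] := Dsn _ Df.
  by rewrite ler_wpM2l ?rnorm_ge0 // pinf_le.
- apply/eqP; rewrite eq_le; apply/andP; split.
    by case: (D0) => f Df; have [_ _ <-] := Dsn _ Df; exact: pinf_le.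
  by apply: le_pinf => // f Df; have [_ _ ->] := Dsn _ Df.
- move=> a; apply/eqP; rewrite eq_le pM /=; apply: le_pinf => // f Df.
  apply: le_trans (Dsq _ a Df).
  by apply: ler_pM; rewrite ?pinf_ge0 // pinf_le.
Qed.

(** * Localization and multiplicative seminorms *)
Definition apow b n := iter n (amul b) aone.

Lemma apowS b n : apow b n.+1 = amul b (apow b n). Proof. by []. Qed.

Lemma apowD b m n : apow b (m + n) = amul (apow b m) (apow b n).
Proof. by elim: m => [|m IH]; rewrite ?amul1 // addSn !apowS IH amulA. Qed.

Definition scaled_seminorm q b n a := q (amul a (apow b n)) / q b ^+ n.

Definition localization q b := pinf (range (scaled_seminorm q b)).

Section Localization.
Variables (q : A -> R) (b : A).
Hypothesis qsq : square_seminorm q.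
Hypothesis qb_gt0 : 0 < q b.

Let q_ge0 a : 0 <= q a.
Proof. by case: qsq => qs _ _; exact: unital_seminorm_ge0. Qed.

Let qM a c : q (amul a c) <= q a * q c.
Proof. by case: qsq. Qed.

Let qpow n : 0 < q b ^+ n. Proof. exact: exprn_gt0. Qed.

Lemma apow_le n : q (apow b n) <= q b ^+ n.
Proof.
elim: n => [|n IH]; first by rewrite expr0; case: qsq => [[_ _ ->]].
by rewrite apowS exprS; apply: le_trans (qM _ _) _; rewrite ler_pM2l.
Qed.

(** Squaring is the only exact information, so it is propagated along powers of 2;
    submultiplicativity then squeezes the exponents in between. *)
Lemma apow2 n : q (apow b (2 ^ n)) = q b ^+ (2 ^ n).
Proof.
elim: n => [|n IH]; first by rewrite apowS amulr1 expr1.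
by rewrite expnS mul2n -addnn apowD exprD; case: qsq => _ _ ->; rewrite IH.
Qed.

Lemma apow_eq n : q (apow b n) = q b ^+ n.
Proof.
apply/eqP; rewrite eq_le apow_le /=.
have n2 : (n <= 2 ^ n)%N by exact: ltnW (ltn_expl _ _).
have := apow2 n; rewrite -{1 2}(subnK n2) apowD exprD => h.
rewrite -(ler_pM2l (qpow (2 ^ n - n))) -h.
by apply: le_trans (qM _ _) _; rewrite ler_wpM2r // apow_le.
Qed.

Let scaledE n a : q (amul a (apow b n)) = scaled_seminorm q b n a * q b ^+ n.
Proof. by rewrite /scaled_seminorm divfK // gt_eqF. Qed.

Let scaled_ge0 n a : 0 <= scaled_seminorm q b n a.
Proof. by rewrite divr_ge0 // ltW. Qed.

Let scaledM n m a c : scaled_seminorm q b (n + m) (amul a c) <=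
  scaled_seminorm q b n a * scaled_seminorm q b m c.
Proof.
rewrite ler_pdivrMr // exprD mulrACA -!scaledE apowD amulACA; exact: qM.
Qed.

Let scaled_unital n : unital_seminorm (scaled_seminorm q b n).
Proof.
case: qsq => [[qD qZ q1] _ _]; split.
- by move=> a c; rewrite -mulrDl ler_pM2r ?invr_gt0 // amulDl.
- by move=> k a; rewrite /scaled_seminorm amulZl qZ mulrA.
- by rewrite /scaled_seminorm amul1 apow_eq divff // gt_eqF.
Qed.

Let scaled_le n m a : (n <= m)%N ->
  scaled_seminorm q b m a <= scaled_seminorm q b n a.
Proof.
move=> /subnKC <-; rewrite -{1}(amulr1 a); apply: le_trans (scaledM _ _ _ _) _.
by case: (scaled_unital (m - n)) => _ _ ->; rewrite mulr1.
Qed.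

Let range_ge0 f : range (scaled_seminorm q b) f -> forall a, 0 <= f a.
Proof. by move=> [n _ <-]. Qed.

Let range0 : range (scaled_seminorm q b) !=set0.
Proof. by exists (scaled_seminorm q b 0), 0%N. Qed.

(** The quotients decrease with n, so they form a directed family. *)
Lemma localization_square : square_seminorm (localization q b).
Proof.
apply: pinf_square_seminorm => //.
- by move=> f [n _ <-].
- move=> _ _ [n _ <-] [m _ <-].
  exists (scaled_seminorm q b (maxn n m)); first by exists (maxn n m).
  by move=> a; rewrite !scaled_le ?leq_maxl ?leq_maxr.
- move=> _ _ [n _ <-] [m _ <-].
  by exists (scaled_seminorm q b (n + m)) => [|a c //]; exists (n + m)%N.
- move=> _ a [n _ <-]; apply: le_trans (scaled_le (amul a a) (leq_addr n n)).
  rewrite ler_pdivlMr // exprD mulrACA -!scaledE apowD amulACA.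
  by case: qsq => _ _ ->.
Qed.

Lemma localization_le a : localization q b a <= q a.
Proof.
apply: le_trans (pinf_le range0 range_ge0 _ (_ : _ (scaled_seminorm q b 0))) _.
  by exists 0%N.
by rewrite /scaled_seminorm expr0 divr1 amulr1.
Qed.

(** Elements against which q is already multiplicative remain so: this is what
    keeps the value at the distinguished element along the minimization. *)
Lemma localization_homog c k : (forall a, q (amul a c) = k * q a) ->
  forall a, localization q b (amul a c) = k * localization q b a.
Proof.
move=> qc a.
have sc n : scaled_seminorm q b n (amul a c) = k * scaled_seminorm q b n a.
  by rewrite /scaled_seminorm mulrA -qc -!amulA (amulC c).
have k0 : 0 <= k.
  by case: (qsq) => [[_ _ q1] _ _]; rewrite -[k]mulr1 -q1 -qc.
apply/eqP; rewrite eq_le; apply/andP; split.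
  rewrite mulrC; apply: le_pinfM => // _ [n _ <-]; rewrite mulrC -sc.
  by apply: pinf_le => //; exists n.
apply: le_pinf => // _ [n _ <-]; rewrite sc ler_wpM2l //.
by apply: pinf_le => //; exists n.
Qed.

(** Multiplying by b shifts the index n of the quotient by one. *)
Lemma localization_self a : localization q b (amul a b) = q b * localization q b a.
Proof.
have sc n : scaled_seminorm q b n (amul a b) = q b * scaled_seminorm q b n.+1 a.
  rewrite /scaled_seminorm -amulA -apowS exprS invfM [RHS]mulrCA.
  by rewrite mulVKf ?gt_eqF.
apply/eqP; rewrite eq_le; apply/andP; split.
  rewrite mulrC; apply: le_pinfM => //.
  move=> _ [n _ <-]; rewrite mulrC.
  apply: (@le_trans _ _ (q b * scaled_seminorm q b n.+1 a)).
    by rewrite -sc; apply: pinf_le => //; exists n.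
  by rewrite ler_pM2l // scaled_le.
apply: le_pinf => // _ [n _ <-]; rewrite sc ler_pM2l //.
by apply: pinf_le => //; exists n.+1.
Qed.

End Localization.

Definition multiplicative_seminorm q :=
  square_seminorm q /\ forall a b, q (amul a b) = q a * q b.

(** Zorn's lemma runs over the seminorms below q0 that are multiplicative against
    a0 with factor q0(a0); taking a = 1 in that condition recovers the value at
    a0 for the minimal one. Minimality makes it equal to its localization at any
    b with q(b) > 0, hence multiplicative against b. *)
Lemma exists_multiplicative_seminorm q0 (a0 : A) :
  square_seminorm q0 -> 0 < q0 a0 ->
  exists q, [/\ multiplicative_seminorm q, forall a, q a <= q0 a & q a0 = q0 a0].
Proof.
move=> q0sq q0a0.
pose P (q : A -> R) := square_seminorm q /\ ((forall a, q a <= q0 a) /\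
  forall a, q (amul a a0) = q0 a0 * q a).
have P0 : P (localization q0 a0).
  split; first exact: localization_square.
  by split=> a; [exact: localization_le|exact: localization_self].
pose T := {q | P q}.
pose ge (q r : T) := `[< forall a, sval r a <= sval q a >].
have [] := @Zorn T ge.
- by move=> q; apply/asboolP.
- move=> q r s /asboolP qr /asboolP rs; apply/asboolP => a.
  exact: le_trans (rs a) (qr a).
- move=> [q Pq] [r Pr] /asboolP qr /asboolP rq; apply: eq_exist.
  by apply/funext => a; apply/eqP; rewrite eq_le; apply/andP.
- move=> F Ftot; have [[r Fr]|F0] := pselect (F !=set0); last first.
    by exists (exist _ _ P0) => s Fs; case: F0; exists s.
  pose D := [set sval s | s in F].
  have D0 : D !=set0 by exists (sval r), r.
  have Dsn f : D f -> unital_seminorm f by case=> -[s [[ssn _ _] _]] /= _ <-.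
  have Dge0 f : D f -> forall a, 0 <= f a.
    by move=> Df a; apply: unital_seminorm_ge0; exact: Dsn.
  have Dmin f g : D f -> D g -> exists2 h, D h & forall a, h a <= f a /\ h a <= g a.
    move=> [s Fs <-] [t Ft <-]; case: (Ftot s t Fs Ft) => /asboolP st.
      by exists (sval t); [exists t|move=> a; split].
    by exists (sval s); [exists s|move=> a; split].
  have PD : P (pinf D).
    split; [|split].
    + apply: pinf_square_seminorm => //.
        move=> f g Df Dg; have [h Dh hle] := Dmin _ _ Df Dg.
        exists h => // a b.
        have h0 := Dge0 _ Dh.
        apply: (@le_trans _ _ (h a * h b)).
          by case: Dh => -[s [[_ sM _] _]] /= _ <-.
        by apply: ler_pM => //; [case: (hle a)|case: (hle b)].
      by move=> f a [[s [[_ _ ssq] _]] /= _ <-]; rewrite ssq.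
    + move=> a; apply: (le_trans (pinf_le D0 Dge0 a (_ : D (sval r)))).
        by exists r.
      by case: (svalP r) => _ [].
    + move=> a; apply/eqP; rewrite eq_le; apply/andP; split.
        rewrite mulrC; apply: le_pinfM => //; first exact: ltW.
        move=> f Df; have := pinf_le D0 Dge0 (amul a a0) Df; rewrite mulrC.
        by case: Df => -[s [ssq [sle sa0]]] /= _ <-; rewrite sa0.
      apply: le_pinf => // f Df; have := pinf_le D0 Dge0 a Df.
      by case: Df => -[s [ssq [sle sa0]]] /= _ <-; rewrite sa0 ler_pM2l.
  exists (exist _ _ PD) => s Fs; apply/asboolP => a /=.
  by apply: pinf_le => //; exists s.
move=> [q Pq] qmin; have [qsq [qle qa0]] := Pq; exists q.
have qge0 a : 0 <= q a by case: qsq => qs _ _; exact: unital_seminorm_ge0.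
split => //; last first.
  by have := qa0 aone; case: (qsq) => [[_ _ ->] _ _]; rewrite amul1 mulr1.
split=> // a b; have := qge0 b; rewrite le_eqVlt => /orP[/eqP qb0|qb].
  apply/eqP; rewrite eq_le -{2}qb0 mulr0 qge0 andbT.
  by case: qsq => _ qM _; exact: qM.
have Pl : P (localization q b).
  split; first exact: localization_square.
  split=> c; first by apply: le_trans (qle c); exact: localization_le.
  exact: localization_homog.
have /(congr1 sval) /= lq : exist _ _ Pl = exist _ q Pq.
  apply: qmin; apply/asboolP => c /=; exact: localization_le.
by rewrite mulrC -{1 3}lq; exact: localization_self.
Qed.

End Seminorms.

(** * Compact subsets of the complex plane *)
Lemma dist_continuous (K L : numFieldType) (f : K -> L) :
  (forall z e, 0 < e -> exists2 d, 0 < d &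
    forall w, `|z - w| < d -> `|f z - f w| < e) -> continuous f.
Proof.
move=> fc z; have zF : Filter (nbhs z) by exact: nbhs_filter.
apply/cvgrPdist_lt => e e0; have [d d0 dw] := fc z e e0.
have /cvgrPdist_lt /(_ _ d0) : (fun w : K => w) @ z --> z by exact: cvg_id.
by apply: filterS.
Qed.

Section Discs.
Local Open Scope complex_scope.
Variable R : realType.
Local Notation C := (R[i] : numClosedFieldType).

Lemma real_complex_continuous : continuous (fun x : R => x%:C : C).
Proof.
move=> x; apply/cvgrPdist_lt => e e0.
have ee : e = (complex.Re e)%:C by rewrite RRe_real // gtr0_real.
have {}e0 : 0 < complex.Re e by move: e0; rewrite {1}ee ltcR.
have /cvgrPdist_lt /(_ _ e0) : (id : R -> R) @ x --> x by exact: cvg_id.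
apply: filterS => y xy; rewrite ee -rmorphB /= rnormE rnorm_real ltcR.
exact: xy.
Qed.

(** A square contains the disc, and is compact as a product of segments. *)
Lemma disc_sub_compact (r : R) :
  exists2 K : set C, compact K & forall z, rnorm z <= r -> K z.
Proof.
pose f (p : R * R) : C := (p.1%:C : C) + ('i%C : C) * (p.2%:C : C).
exists (f @` (`[- r, r] `*` `[- r, r])).
  apply: continuous_compact; last first.
    by apply: compact_setX; exact: segment_compact.
  apply: continuous_subspaceT => p; apply: cvgD.
    apply: (@cvg_comp _ _ _ fst (fun x : R => x%:C : C)).
      exact: cvg_fst.
    exact: real_complex_continuous.
  apply: cvgM; first exact: cvg_cst.
  apply: (@cvg_comp _ _ _ snd (fun x : R => x%:C : C)).
    exact: cvg_snd.
  exact: real_complex_continuous.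
move=> z zr; exists (complex.Re z, complex.Im z); last first.
  by rewrite /f /= -complexE.
split; rewrite /= in_itv /= -ler_norml.
  by apply: le_trans zr; rewrite -lecR -rnormE; exact: normc_ge_Re.
apply: le_trans zr; rewrite -lecR -rnormE.
have := normc_ge_Re (z * 'i%C); rewrite ReiNIm normrN normrM.
suff -> : `|'i%C : R[i]| = 1 by rewrite mulr1.
by rewrite normc_def /= expr0n expr1n add0r sqrtr1.
Qed.

Lemma rnorm_lipschitz (f : C -> R) : 
  (forall z w, `|f z - f w| <= rnorm (z - w)) -> continuous f.
Proof.
move=> fl; apply: (@dist_continuous C) => z e e0.
exists e%:C; first by rewrite ltcR.
by move=> w; rewrite rnormE ltcR; exact: le_lt_trans.
Qed.

End Discs.

(** * Multiplicative seminorms take residues in the complex numbers *)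
Section GelfandMazur.
Local Open Scope complex_scope.
Variables (R : realType) (A : comStarAlgType R[i]) (q : A -> R).
Hypothesis qm : multiplicative_seminorm q.
Implicit Types (a b c x y : A) (z w k : R[i]).

Let q_ge0 a : 0 <= q a.
Proof. by case: qm => [[qs _ _] _]; exact: unital_seminorm_ge0. Qed.

Let qD a b : q (a + b) <= q a + q b. Proof. by case: qm => [[[]]]. Qed.
Let qZ k a : q (k *: a) = rnorm k * q a. Proof. by case: qm => [[[]]]. Qed.
Let q1 : q aone = 1. Proof. by case: qm => [[[]]]. Qed.
Let qM a b : q (amul a b) = q a * q b. Proof. by case: qm. Qed.

Let qN a : q (- a) = q a.
Proof. by rewrite -scaleN1r qZ rnormN rnorm1 mul1r. Qed.

Let qk k : q (k *: aone) = rnorm k. Proof. by rewrite qZ q1 mulr1. Qed.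

Let amulDr_ a b c : amul a (b + c) = amul a b + amul a c.
Proof. by rewrite amulC amulDl !(amulC a). Qed.
Let amulZr_ k a b : amul a (k *: b) = k *: amul a b.
Proof. by rewrite amulC amulZl amulC. Qed.

Let sub_scalar_sqr y w : q (y - w *: aone) * q (y + w *: aone) =
  q (amul y y - w ^+ 2 *: aone).
Proof.
rewrite -qM; congr q.
rewrite amulDl -scaleNr amulZl !amulDr_ !amulZr_ amul1 amulr1 scalerDr scalerA.
by rewrite mulNr -expr2 addrA !scaleNr addrK amul1.
Qed.

(** Ostrowski's argument. If the distance from x to the scalars is positive, it
    is attained, and after scaling one gets an element of seminorm one at
    distance one from the scalars. Such elements are stable under squaring and
    under small translations by scalars, hence under large ones, which the
    triangle inequality forbids. *)
Let extremal y := q y = 1 /\ forall z, 1 <= q (y - z *: aone).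

Let extremalD y w : extremal y -> 1 <= q (y + w *: aone).
Proof. by move=> [_ /(_ (- w))]; rewrite scaleNr opprK. Qed.

Let extremal_sqr y : extremal y -> extremal (amul y y).
Proof.
move=> ey; have [y1 yz] := ey; split=> [|z]; first by rewrite qM y1 mulr1.
rewrite -[z]sqrtCK -sub_scalar_sqr -[leLHS]mulr1.
by apply: ler_pM => //; exact: extremalD.
Qed.

(** (y - w)(y + w) = y^2 - w^2 and q(y + w) >= 1, so passing from (y, w) to the
    squares does not decrease q(y - w); iterate. *)
Let extremal_le n y w : extremal y ->
  q (y - w *: aone) <= 1 + rnorm w ^+ (2 ^ n).
Proof.
elim: n y w => [|n IH] y w ey.
  rewrite expr1; apply: le_trans (qD _ _) _.
  by rewrite qN qk; case: ey => ->.
apply: (@le_trans _ _ (q (y - w *: aone) * q (y + w *: aone))).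
  by rewrite ler_peMr //; exact: extremalD.
rewrite sub_scalar_sqr expnS exprM [rnorm w ^+ 2]expr2 -rnormM.
by rewrite -expr2; apply: IH; exact: extremal_sqr.
Qed.

Let extremal_shift y w : extremal y -> rnorm w <= 2^-1 -> extremal (y - w *: aone).
Proof.
move=> ey w2; have [y1 yz] := ey; split; last first.
  by move=> z; rewrite -addrA -opprD -scalerDl.
apply/eqP; rewrite eq_le yz andbT leNgt; apply/negP => lt1.
pose d := q (y - w *: aone) - 1; have d0 : 0 < d by rewrite subr_gt0.
pose k := Num.bound d^-1.
have := extremal_le k w ey; rewrite leNgt => /negP; apply.
rewrite -ltrBrDl -/d.
apply: le_lt_trans (_ : (2^-1) ^+ (2 ^ k) < d).
  by rewrite lerXn2r ?nnegrE ?rnorm_ge0 ?invr_ge0.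
rewrite exprVn -[ltRHS]invrK ltf_pV2 ?posrE ?exprn_gt0 ?invr_gt0 //.
apply: lt_trans (archi_boundP _) _; first by rewrite invr_ge0 ltW.
rewrite -natrX ltr_nat; apply: (leq_trans (ltn_expl k (isT : 1 < 2)%N)).
by rewrite leq_exp2l // ltnW // ltn_expl.
Qed.

Let not_extremal y : ~ extremal y.
Proof.
move=> ey.
have half : rnorm (2^-1 : R[i]) = 2^-1.
  by rewrite /rnorm normfV -[2]/(2%:R) normr_nat -(rmorph_nat (real_complex R)) -fmorphV.
(* Six steps of length 1/2 reach seminorm at least 3 - q(y) = 2 > 1. *)
have en n : extremal (y - (2^-1 *+ n) *: aone).
  elim: n => [|n IH]; first by rewrite mulr0n scale0r subr0.
  rewrite mulrSr scalerDl opprD addrA; apply: extremal_shift => //.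
  by rewrite half.
have [y1 _] := ey; have [y6 _] := en 6%N.
have : q ((2^-1 *+ 6) *: aone) <= q y + q (y - (2^-1 *+ 6) *: aone).
  rewrite -[q (y - _)]qN; apply: le_trans (qD _ _).
  by rewrite opprB addrC subrK.
rewrite y1 y6 -scaler_nat -scalerA qZ qk half /rnorm normr_nat.
rewrite -(rmorph_nat (real_complex R)) /=; lra.
Qed.

(** Outside the disc of radius 2 q(x) the distance to x exceeds q(x), its value at 0,
    so a minimum over a compact set containing this disc is global. *)
Lemma exists_residue x : exists z, q (x - z *: aone) = 0.
Proof.
pose f z := q (x - z *: aone).
have fB z w : f w - f z <= rnorm (z - w).
  rewrite lerBlDr addrC -qk; apply: le_trans (qD _ _).
  by rewrite scalerBl addrA subrK.
have [K cK Kr] := disc_sub_compact (2 * q x).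
have cf : continuous (f : (R[i] : numClosedFieldType) -> R).
  apply: rnorm_lipschitz => z w; rewrite ler_norml lerNl opprB fB /=.
  by rewrite -[z - w]opprB rnormN fB.
have [|z0 _ z0min] := compact_EVT_min _ cK (continuous_subspaceT cf).
  by exists 0; apply: Kr; rewrite rnorm0 mulr_ge0.
exists z0; apply/eqP; rewrite eq_le q_ge0 andbT leNgt; apply/negP => m0.
have fmin z : f z0 <= f z.
  have [zr|zr] := leP (rnorm z) (2 * q x); first by apply: z0min; exact/mem_set/Kr.
  apply: (@le_trans _ _ (f 0)).
    by apply: z0min; apply/mem_set/Kr; rewrite rnorm0 mulr_ge0.
  have := qD (x - z *: aone) (- x); rewrite addrAC subrr sub0r !qN qk.
  rewrite /f scale0r subr0; lra.
apply: (@not_extremal (((f z0)^-1)%:C *: (x - z0 *: aone))).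
have q_inv a : q (((f z0)^-1)%:C *: a) = (f z0)^-1 * q a.
  by rewrite qZ rnorm_real ger0_norm // invr_ge0 /f.
split; first by rewrite q_inv mulVf // gt_eqF.
move=> z; rewrite -[z](mulKf (_ : (f z0)%:C != 0)); last first.
  by rewrite -(rmorph0 (real_complex R)) (inj_eq (@complexI R)) gt_eqF.
rewrite -fmorphV /= -scalerA -scalerBr q_inv ler_pdivlMl // mulr1.
by rewrite -addrA -opprD -scalerDl; exact: fmin.
Qed.

End GelfandMazur.

(** * Characters *)
Section StarAlgebra.
Variables (C : numClosedFieldType) (A : comStarAlgType C).
Implicit Types a b c : A.

Lemma star_amulDr a b c : amul a (b + c) = amul a b + amul a c.
Proof. by rewrite amulC amulDl ![amul _ a]amulC. Qed.

Lemma star_amulZr k a b : amul a (k *: b) = k *: amul a b.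
Proof. by rewrite amulC amulZl amulC. Qed.

Lemma star_amulBr a b c : amul a (b - c) = amul a b - amul a c.
Proof. by rewrite star_amulDr -scaleN1r star_amulZr scaleN1r. Qed.

Lemma star1 : star (aone : A) = aone.
Proof. by rewrite -[LHS]amul1 -{1}(starK aone) -starM amul1 starK. Qed.

Lemma starN a : star (- a) = - star a.
Proof. by rewrite -scaleN1r starZ rmorphN1 scaleN1r. Qed.

Definition character (f : A -> C) := [/\ scalar f, f aone = 1,
  {morph f : a b / amul a b >-> a * b} & {morph f : a / star a >-> a^*}].

Section Character.
Variable f : A -> C.
Hypothesis fc : character f.

Lemma character_lin : scalar f. Proof. by case: fc. Qed.
Lemma character1 : f aone = 1. Proof. by case: fc. Qed.
Lemma characterM a b : f (amul a b) = f a * f b. Proof. by case: fc. Qed.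
Lemma character_star a : f (star a) = (f a)^*. Proof. by case: fc. Qed.

Lemma character0 : f 0 = 0.
Proof. by have := character_lin (-1) 0 0; rewrite scaleN1r addNr mulN1r addNr. Qed.

Lemma characterZ k a : f (k *: a) = k * f a.
Proof. by have := character_lin k a 0; rewrite !addr0 character0 addr0. Qed.

Lemma characterD a b : f (a + b) = f a + f b.
Proof. by have := character_lin 1 a b; rewrite scale1r mul1r. Qed.

Lemma characterN a : f (- a) = - f a.
Proof. by rewrite -scaleN1r characterZ mulN1r. Qed.

Lemma characterB a b : f (a - b) = f a - f b.
Proof. by rewrite characterD characterN. Qed.

End Character.
End StarAlgebra.

Section ExistsCharacter.
Local Open Scope complex_scope.
Variables (R : realType) (A : comCStarAlgType R[i]).
Implicit Types a b : A.

Lemma rnorm_amul a b : rnorm (amul a b) <= rnorm a * rnorm b.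
Proof. by rewrite -lecR rmorphM /= -!rnormE; exact: norm_amul. Qed.

Lemma rnorm_cstar a : rnorm (amul (star a) a) = rnorm a ^+ 2.
Proof. by apply: complexI; rewrite rmorphXn /= -!rnormE; exact: cstar_identity. Qed.

Lemma rnorm_square_seminorm : aone != 0 :> A -> square_seminorm (@rnorm R A).
Proof.
move=> A1; split; [split| |].
- exact: ler_rnormD.
- exact: rnormZ.
- have := rnorm_cstar aone; rewrite star1 amul1 expr2 => /eqP.
  rewrite -subr_eq0 -{1}[rnorm _]mulr1 -mulrBr mulf_eq0 subr_eq0.
  case/orP => /eqP // /rnorm0_eq0 one0.
  by rewrite one0 eqxx in A1.
- exact: rnorm_amul.
- move=> a; apply/eqP; rewrite -(@eqrXn2 _ 2) ?mulr_ge0 ?rnorm_ge0 //.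
  rewrite -rnorm_cstar starM amulACA.
  have {1}<- : star (amul (star a) a) = amul (star a) a by rewrite starM starK.
  by rewrite rnorm_cstar rnorm_cstar; apply/eqP; ring.
Qed.

Lemma Im_sqr_le (z : R[i]) : complex.Im z ^+ 2 <= rnorm z ^+ 2.
Proof.
have : complex.Re z ^+ 2 + complex.Im z ^+ 2 = rnorm z ^+ 2.
  by apply: complexI; rewrite add_Re2_Im2 rmorphXn /= rnormE.
by move=> <-; rewrite lerDr sqr_ge0.
Qed.

(** With f(a) = u + iv and t real, (v + t)^2 <= |f(a + it)|^2 <= |a|^2 + t^2 by the
    C*-identity; this fails for large t of the sign of v unless v = 0. *)
Lemma selfadjoint_real (f : A -> R[i]) a : scalar f -> f aone = 1 ->
  (forall b, rnorm (f b) <= rnorm b) -> star a = a -> complex.Im (f a) = 0.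
Proof.
move=> flin f1 fle sa.
have [A1|A0] := eqVneq (aone : A) 0.
  by have := f1; rewrite A1 => /eqP; have := flin (-1) 0 0;
    rewrite scaleN1r addNr mulN1r addNr => ->; rewrite eq_sym oner_eq0.
have [_ _ n1] : unital_seminorm (@rnorm R A) by case: (rnorm_square_seminorm A0).
have bound t : (complex.Im (f a) + t) ^+ 2 <= rnorm a ^+ 2 + t ^+ 2.
  have ft : f (('i%C * t%:C) *: aone + a) = 'i%C * t%:C + f a.
    by rewrite flin f1 mulr1.
  have Imt : complex.Im ('i%C * t%:C + f a) = complex.Im (f a) + t.
    by case: (f a) => u v /=; ring.
  rewrite -Imt -ft; apply: le_trans (Im_sqr_le _) _.
  set b := _ *: aone + a.
  apply: (@le_trans _ _ (rnorm b ^+ 2)).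
    by rewrite lerXn2r ?nnegrE ?rnorm_ge0.
  rewrite -(rnorm_cstar b).
  have -> : amul (star b) b = amul (star a) a + (t ^+ 2)%:C *: aone.
    rewrite /b starD starZ star1 sa.
    have -> : Num.conj ('i%C * t%:C : R[i]) = - ('i%C * t%:C).
      by apply/eqP; rewrite eq_complex /=; apply/andP; split; apply/eqP; ring.
    rewrite amulDl amulZl amul1 star_amulDr star_amulZr amulr1 scalerDr scalerA.
    rewrite (scaleNr _ a) addrA subrK addrC; congr (_ + _ *: _).
    by apply/eqP; rewrite eq_complex /=; apply/andP; split; apply/eqP; ring.
  apply: le_trans (ler_rnormD _ _) _.
  by rewrite rnorm_cstar lerD2l rnormZ n1 mulr1 rnorm_real ger0_norm ?sqr_ge0.
have [//|Im0] := eqVneq (complex.Im (f a)) 0.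
(* For this t the bound reads v^2 + 2 |a|^2 <= |a|^2. *)
have := bound (rnorm a ^+ 2 / complex.Im (f a)).
set v := complex.Im _ in Im0 *; set n := rnorm a ^+ 2.
have n0 : 0 <= n by rewrite sqr_ge0.
have -> : (v + n / v) ^+ 2 = v ^+ 2 + 2 * n + (n / v) ^+ 2 by field.
have : 0 < v ^+ 2 by rewrite exprn_even_gt0.
lra.
Qed.

Lemma functional_star (f : A -> R[i]) : scalar f -> f aone = 1 ->
  (forall b, rnorm (f b) <= rnorm b) -> forall a, f (star a) = Num.conj (f a).
Proof.
move=> flin f1 fle a.
have real b : star b = b -> complex.Im (f b) = 0 by exact: selfadjoint_real.
have f0 : f 0 = 0.
  by have := flin (-1) 0 0; rewrite scaleN1r addNr mulN1r addNr.
have fZ k b : f (k *: b) = k * f b by rewrite -[k *: b]addr0 flin f0 addr0.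
have fD b c : f (b + c) = f b + f c by have := flin 1 b c; rewrite scale1r mul1r.
have := real (a + star a); rewrite starD starK addrC => /(_ erefl).
have := real ('i%C *: (a - star a)).
rewrite starZ starD starN starK.
have -> : Num.conj ('i%C : R[i]) = - 'i%C.
  by apply/eqP; rewrite eq_complex /= oppr0 !eqxx.
rewrite scaleNr -scalerN opprB addrC => /(_ erefl).
rewrite fZ !fD -scaleN1r fZ mulN1r.
case: (f a) => u v; case: (f (star a)) => u' v' /= h1 h2.
by apply/eqP; rewrite eq_complex /=; apply/andP; split; apply/eqP; lra.
Qed.

(** The residue map of a multiplicative seminorm q is unique, since distinct scalars
    have positive distance, and so it inherits linearity and multiplicativity
    from q; moreover q(a) is the modulus of the residue of a. *)
Lemma exists_character (a0 : A) : a0 != 0 ->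
  exists2 f : A -> R[i], character f & rnorm (f a0) = rnorm a0.
Proof.
move=> a00.
have A1 : aone != 0 :> A.
  apply: contra_neq a00 => one0; rewrite -[a0]amul1 one0.
  by have := amulZl 0 0 a0; rewrite !scale0r.
have [|q [qm qle qa0]] :=
    exists_multiplicative_seminorm (a0 := a0) (rnorm_square_seminorm A1).
  rewrite lt_neqAle rnorm_ge0 andbT eq_sym.
  by apply: contra_neq a00; exact: rnorm0_eq0.
have [[[qD qZ q1] _ _] qM] := qm.
have [f fq] := choice (exists_residue qm).
have q0 a : 0 <= q a by apply: unital_seminorm_ge0.
have qN a : q (- a) = q a by rewrite -scaleN1r qZ rnormN rnorm1 mul1r.
have uniq a z : q (a - z *: aone) = 0 -> f a = z.
  move=> az; apply/eqP; rewrite -subr_eq0; apply/eqP/rnorm0_eq0/eqP.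
  rewrite eq_le rnorm_ge0 andbT -[leLHS]mulr1 -q1 -qZ scalerBl.
  have -> : f a *: aone - z *: aone = - (a - f a *: aone) + (a - z *: aone).
    by rewrite opprB addrA subrK.
  by apply: le_trans (qD _ _) _; rewrite qN fq az addr0.
have qf a : q a = rnorm (f a).
  apply/eqP; rewrite eq_le -[rnorm (f a)]mulr1 -q1 -qZ; apply/andP; split.
    by rewrite -{1}[a](subrK (f a *: aone)) (le_trans (qD _ _)) // fq add0r.
  have -> : f a *: aone = a + - (a - f a *: aone) by rewrite subKr.
  by rewrite (le_trans (qD _ _)) // qN fq addr0.
have flin : scalar f.
  move=> k a b; apply: uniq; apply/eqP; rewrite eq_le q0 andbT.
  have -> : k *: a + b - (k * f a + f b) *: aone =
      k *: (a - f a *: aone) + (b - f b *: aone).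
    by rewrite scalerBr scalerA scalerDl opprD addrACA.
  by apply: le_trans (qD _ _) _; rewrite qZ !fq mulr0 addr0.
have f1 : f aone = 1 by apply: uniq; rewrite scale1r subrr -(scale0r aone) qZ rnorm0 mul0r.
have fle b : rnorm (f b) <= rnorm b by rewrite -qf.
exists f; last by rewrite -qf.
split => //; last exact: functional_star.
move=> a b; apply: uniq; apply/eqP; rewrite eq_le q0 andbT.
have -> : amul a b - (f a * f b) *: aone =
    amul a (b - f b *: aone) + f b *: (a - f a *: aone).
  rewrite -[- (f b *: _)]scaleNr star_amulDr star_amulZr amulr1 scalerBr scalerA scaleNr.
  by rewrite addrA subrK (mulrC (f b)).
by apply: le_trans (qD _ _) _; rewrite qM qZ !fq !mulr0 addr0.
Qed.

End ExistsCharacter.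

(** * Convergence and compactness *)
Lemma cvg_initial (S : choiceType) (T : topologicalType) (g : S -> T)
    (F : set_system S) (s : initial_topology g) :
  Filter F -> g @ F --> g s -> F --> s.
Proof.
move=> FF gF U [_ [[W oW <-]] Ws WU].
by apply: filterS WU _; apply: gF; exact: open_nbhs_nbhs.
Qed.

Lemma cvg_ptws (I : choiceType) (T : topologicalType)
    (F : set_system {ptws I -> T}) (f : {ptws I -> T}) :
  Filter F -> (forall i, (fun h : {ptws I -> T} => h i) @ F --> f i) -> F --> f.
Proof.
move=> FF Fi; apply/cvg_sup => i.
by apply: (@cvg_initial _ _ (fun h : I -> T => h i)) => //; exact: Fi.
Qed.

Lemma ptws_eval_continuous (I : choiceType) (T : topologicalType) (i : I) :
  continuous (fun h : {ptws I -> T} => h i).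
Proof. exact: (@proj_continuous I (fun=> T) i). Qed.

Lemma compact_set_type (T : topologicalType) (K : set T) :
  compact K -> compact [set: set_type K].
Proof.
move=> cK F PF _; have [|p [Kp clp]] := cK (set_val @ F) _.
  by apply: (@filterE _ F) => x; exact: set_valP.
exists (exist _ p (mem_set Kp)); split=> // U V FU [_ [[W oW <-] Wp WV]].
have [|_ [[u Uu <-] Wu]] := clp (set_val @` U) W _ (open_nbhs_nbhs (conj oW Wp)).
  by apply: (@filterS _ F _ U _ _ FU) => x Ux; exists x.
by exists u; split=> //; exact: WV.
Qed.

(** Compactness as an induction principle: a property of sets that is local, and
    stable under subsets and finite unions, holds for the whole space. Otherwise
    the complements of the sets having it form a proper filter, and its cluster
    point contradicts locality. *)
Lemma compact_ind (X : topologicalType) (Q : set X -> Prop) :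
  compact [set: X] -> (forall U V, U `<=` V -> Q V -> Q U) ->
  Q set0 -> (forall U V, Q U -> Q V -> Q (U `|` V)) ->
  (forall x : X, exists2 U, nbhs x U & Q U) -> Q [set: X].
Proof.
move=> cX Qsub Q0 QU Qloc; apply: contrapT => QX.
pose F : set_system X := [set U | Q (~` U)].
have FF : Filter F.
  split; rewrite /F /=.
  - by rewrite setCT.
  - by move=> U V FU FV; rewrite /= setCI; exact: QU.
  - by move=> U V UV /=; apply: Qsub; exact: subsetC.
have PF : ProperFilter F by apply: Build_ProperFilter_ex => U FU;
  apply: contrapT => /forallNP U0; apply: QX;
  rewrite -setC0; have -> : set0 = U by rewrite predeqE => x; split => // /U0.
have [x [_ clx]] := cX F PF filterT.
have [U xU QUU] := Qloc x.
have FU : F (~` U) by rewrite /F /= setCK.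
by have [y [nUy Uy]] := clx _ _ FU xU.
Qed.

(** * Stone-Weierstrass *)
Section Approximation.
Variables (R : realType) (X : topologicalType) (S : set (X -> R)).
Hypothesis cX : compact [set: X].
Hypothesis Scst : forall k, S (cst k).
Hypothesis SD : forall f g, S f -> S g -> S (fun x => f x + g x).
Hypothesis SM : forall f g, S f -> S g -> S (fun x => f x * g x).
Hypothesis Scont : forall f, S f -> continuous f.
Hypothesis Sbump : forall (x : X) U, nbhs x U ->
  exists2 h, S h & [/\ forall y, 0 <= h y, h x = 0 &
    exists2 d : R, 0 < d & forall y, h y < d -> U y].

Definition uniform_closure (g : X -> R) :=
  forall e : R, 0 < e -> exists2 s, S s & forall x, `|g x - s x| <= e.

Lemma continuous_bounded (f : X -> R) : continuous f ->
  exists2 M : R, 0 < M & forall x, `|f x| <= M.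
Proof.
move=> cf.
have : exists2 M : R, 0 < M & forall x, [set: X] x -> `|f x| <= M.
  apply: (@compact_ind X
    (fun U => exists2 M : R, 0 < M & forall x, U x -> `|f x| <= M)) => //.
  - by move=> U V UV [M M0 h]; exists M => // x /UV; exact: h.
  - by exists 1.
  - move=> U V [M M0 h] [N N0 k]; exists (M + N); first exact: addr_gt0.
    move=> x [/h|/k] ?; first by apply: ler_wpDr => //; exact: ltW.
    by apply: ler_wpDl => //; exact: ltW.
  - move=> x; exists [set y | `|f x - f y| < 1].
      by have /cvgrPdist_lt /(_ 1 ltr01) := cf x.
    exists (`|f x| + 1); first by rewrite ltr_wpDl.
    move=> y /= /ltW xy; rewrite -[f y](subKr (f x)).
    by rewrite (le_trans (ler_normB _ _)) // lerD2l.
by move=> [M M0 h]; exists M => // x; exact: h.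
Qed.

(** Newton-like iteration p + (t^2 - p^2) / 2 for the square root of t^2. *)
Fixpoint abs_approx (t : R) n : R :=
  if n is m.+1 then abs_approx t m + (t ^+ 2 - abs_approx t m ^+ 2) / 2 else 0.

(** The error e_n = |t| - p_n satisfies e_(n+1) = e_n (1 - (|t| + p_n) / 2)
    <= e_n (1 - |t| / 2), which makes e_n (2 + n |t|) decrease in n. This gives
    a bound of order 1 / n uniform in t. *)
Lemma abs_approx_bound t n : `|t| <= 1 ->
  0 <= `|t| - abs_approx t n /\ 0 <= abs_approx t n /\
  (`|t| - abs_approx t n) * (2 + n%:R * `|t|) <= 2 * `|t|.
Proof.
move=> t1; have t0 : 0 <= `|t| by [].
elim: n => [|n [IH1 [IH2 IH3]]]; first by rewrite /= subr0; split => //; split => //; lra.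
rewrite /= -[t ^+ 2]real_normK ?num_real //.
set u := `|t| in t1 t0 IH1 IH3 *; set p := abs_approx t n in IH1 IH2 IH3 *.
have -> : u - (p + (u ^+ 2 - p ^+ 2) / 2) = (u - p) * (1 - (u + p) / 2) by field.
split; [|split].
- by apply: mulr_ge0 => //; lra.
- by rewrite subr_sqr; apply: addr_ge0 => //; apply: divr_ge0 => //; apply: mulr_ge0; lra.
apply: le_trans IH3; rewrite -mulrA; apply: ler_wpM2l => //.
have n0 : 0 <= n%:R :> R by exact: ler0n.
apply: (@le_trans _ _ ((1 - u / 2) * (2 + n.+1%:R * u))).
  apply: ler_wpM2r; last lra.
  by apply: addr_ge0 => //; apply: mulr_ge0.
have : 0 <= (n%:R + 1) * (u * u) by rewrite !mulr_ge0 // addr_ge0.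
rewrite -[n.+1%:R]natr1.
have -> : (1 - u / 2) * (2 + (n%:R + 1) * u) =
  2 + n%:R * u - (n%:R + 1) * (u * u) / 2 by field.
lra.
Qed.

Lemma abs_approx_dist t n : `|t| <= 1 -> `| `|t| - abs_approx t n.+1| <= 2 / n.+1%:R.
Proof.
move=> /(abs_approx_bound n.+1) [h1 [h2 h3]]; rewrite ger0_norm //.
have [t0|t0] := eqVneq `|t| 0.
  by rewrite t0 add0r in h1 *; apply: (@le_trans _ _ 0); rewrite ?divr_ge0 // oppr_le0.
have tp : 0 < `|t| by rewrite lt_neqAle eq_sym t0 normr_ge0.
rewrite ler_pdivlMr ?ltr0n // -(ler_pM2r tp) -mulrA; apply: le_trans h3.
by rewrite ler_wpM2l // lerDr.
Qed.

Lemma uniform_closureS s : S s -> uniform_closure s.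
Proof. by move=> Ss e e0; exists s => // x; rewrite subrr normr0 ltW. Qed.

Lemma uniform_closureD g h : uniform_closure g -> uniform_closure h ->
  uniform_closure (fun x => g x + h x).
Proof.
move=> gS hS e e0; have e2 : 0 < e / 2 by rewrite divr_gt0.
have [s Ss sg] := gS _ e2; have [r Sr rh] := hS _ e2.
exists (fun x => s x + r x); first exact: SD.
move=> x; rewrite opprD addrACA [leRHS]splitr.
by apply: le_trans (ler_normD _ _) _; apply: lerD.
Qed.

Lemma uniform_closureZ k g : uniform_closure g ->
  uniform_closure (fun x => k * g x).
Proof.
move=> gS e e0; have k0 : 0 < `|k| + 1 by rewrite ltr_wpDl.
have [s Ss sg] := gS (e / (`|k| + 1)) (divr_gt0 e0 k0).
exists (fun x => k * s x); first by apply: (SM (Scst k)).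
move=> x; rewrite -mulrBr normrM.
apply: (@le_trans _ _ ((`|k| + 1) * `|g x - s x|)).
  by rewrite ler_wpM2r // lerDl.
by rewrite mulrC -ler_pdivlMr.
Qed.

Lemma uniform_closure_abs g : uniform_closure g ->
  uniform_closure (fun x => `|g x|).
Proof.
move=> gS e e0; have e2 : 0 < e / 2 by rewrite divr_gt0.
have [s Ss sg] := gS _ e2; have [M M0 sM] := continuous_bounded (Scont Ss).
have SA n : S (fun x => abs_approx (s x / M) n).
  elim: n => [|n IH] /=; first exact: (Scst 0).
  have -> : (fun x => abs_approx (s x / M) n +
      ((s x / M) ^+ 2 - abs_approx (s x / M) n ^+ 2) / 2) =
    (fun x => abs_approx (s x / M) n + cst (2^-1) x * (cst (M^-1) x * cst (M^-1) x *
       (s x * s x) + cst (-1) x * (abs_approx (s x / M) n * abs_approx (s x / M) n))).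
    by apply/funext => x; rewrite /cst; field; rewrite gt_eqF.
  by do ?[exact: SD|exact: SM|exact: Scst|exact: Ss|exact: IH|apply: SD|apply: SM].
(* The error of the iteration, scaled back by M, is at most 2 M / (n + 1). *)
pose n := Num.bound (4 * M / e).
exists (fun x => M * abs_approx (s x / M) n.+1); first by apply: (SM (Scst M)).
move=> x; have -> : `|g x| - M * abs_approx (s x / M) n.+1 =
  (`|g x| - `|s x|) + M * (`|s x / M| - abs_approx (s x / M) n.+1).
  by rewrite normrM normfV (gtr0_norm M0); field; rewrite gt_eqF.
rewrite [leRHS]splitr; apply: le_trans (ler_normD _ _) _; apply: lerD.
  exact: le_trans (ler_dist_dist _ _) (sg x).
rewrite normrM (gtr0_norm M0).
apply: (@le_trans _ _ (M * (2 / n.+1%:R))).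
  rewrite ler_pM2l //; apply: abs_approx_dist.
  by rewrite normrM normfV (gtr0_norm M0) ler_pdivrMr // mul1r.
rewrite mulrA ler_pdivrMr ?ltr0n //.
have : 4 * M / e < n.+1%:R.
  apply: lt_trans (archi_boundP _) _; first by rewrite divr_ge0 ?ltW // mulr_gt0.
  by rewrite ltr_nat.
rewrite ltr_pdivrMr //; lra.
Qed.

Lemma uniform_closure_min g h : uniform_closure g -> uniform_closure h ->
  uniform_closure (fun x => Num.min (g x) (h x)).
Proof.
move=> gS hS.
have -> : (fun x => Num.min (g x) (h x)) =
    (fun x => 2^-1 * ((g x + h x) + (-1) * `|g x + (-1) * h x|)).
  apply/funext => x; rewrite !mulN1r.
  case: (leP (g x) (h x)) => gh.
    by rewrite ler0_norm ?subr_le0 //; field.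
  by rewrite gtr0_norm ?subr_gt0 //; field.
apply: uniform_closureZ; apply: uniform_closureD; first exact: uniform_closureD.
apply/uniform_closureZ/uniform_closure_abs/uniform_closureD => //.
exact: uniform_closureZ.
Qed.

(** Near each point x the function f is dominated by f(x) + e/4 + k h, where h is a
    nonnegative element of the algebra vanishing at x and k is so large that the
    domination holds everywhere. The minimum of finitely many of these functions
    is close to f. *)
Lemma continuous_uniform_closure (f : X -> R) : continuous f -> uniform_closure f.
Proof.
move=> cf e e0; have [M M0 fM] := continuous_bounded cf.
have e4 : 0 < e / 4 by rewrite divr_gt0.
have : exists2 g, uniform_closure g & (forall y, f y <= g y) /\
    forall y, [set: X] y -> g y <= f y + 3 * (e / 4).
  apply: (@compact_ind X (fun U => exists2 g, uniform_closure g &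
    (forall y, f y <= g y) /\ forall y, U y -> g y <= f y + 3 * (e / 4))) => //.
  - by move=> U V UV [g gS [fg gf]]; exists g => //; split => // y /UV; exact: gf.
  - exists (cst M); first exact/uniform_closureS/Scst.
    by split => // y; apply: le_trans (ler_norm _) (fM y).
  - move=> U V [g gS [fg gf]] [h hS [fh hf]].
    exists (fun x => Num.min (g x) (h x)); first exact: uniform_closure_min.
    split=> [y|y [/gf|/hf]]; first by rewrite le_min fg fh.
      by move=> gy; rewrite ge_min gy.
    by move=> hy; rewrite ge_min hy orbT.
  move=> x; have [h Sh [h0 hx [d d0 hd]]] : exists2 h, S h &
      [/\ forall y, 0 <= h y, h x = 0 &
    exists2 d : R, 0 < d & forall y, h y < d -> [set y | `|f x - f y| < e / 4] y].
    by apply: Sbump; have /cvgrPdist_lt /(_ _ e4) := cf x.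
  (* 2 M bounds the oscillation of f, and h >= d off the neighbourhood. *)
  pose k := 2 * M / d; have k0 : 0 < k by rewrite divr_gt0 // mulr_gt0.
  exists [set y | `|f x - f y| < e / 4 /\ h y < e / 4 / k].
    apply: filterI; first by have /cvgrPdist_lt /(_ _ e4) := cf x.
    have /cvgrPdist_lt /(_ _ (divr_gt0 e4 k0)) := @Scont h Sh x.
    by apply: filterS => y; rewrite hx sub0r normrN ger0_norm.
  exists (fun y => f x + e / 4 + k * h y).
    by apply/uniform_closureS/(SD (Scst _))/(SM (Scst k)).
  split=> y; last first.
    move=> [/ltW]; rewrite ler_norml => /andP[_ fxy].
    rewrite ltr_pdivlMr // mulrC => /ltW; lra.
  have [hyd|dhy] := ltP (h y) d.
    have := hd _ hyd; rewrite /= ltr_norml => /andP[fxy _].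
    have : 0 <= k * h y by rewrite mulr_ge0 // ltW.
    lra.
  have : 2 * M <= k * h y by rewrite mulrAC ler_pdivlMr // ler_pM2l // mulr_gt0.
  have := fM x; have := fM y; rewrite !ler_norml => /andP[_ ?] /andP[? _]; lra.
move=> [g gS [fg gf]]; have [s Ss sg] := gS _ e4; exists s => // x.
have := sg x; have := fg x; have := gf x Logic.I.
by rewrite !ler_norml => ? ? /andP[? ?]; apply/andP; split; lra.
Qed.

End Approximation.

(** * Boundedness of characters *)
Section Completeness.
Variables (R : realType) (V : completeNormedModType R[i]).
Local Open Scope complex_scope.

Lemma rnorm_cauchy_cvg (u : nat -> V) :
  (forall e : R, 0 < e -> exists N, forall n, (N <= n)%N -> rnorm (u N - u n) < e) ->
  exists l, forall e : R, 0 < e ->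
    exists N, forall n, (N <= n)%N -> rnorm (l - u n) < e.
Proof.
move=> uc; have : cvg (u @ \oo).
  apply/cauchy_cvgP/cauchy_exP => e e0.
  have ee : e = (complex.Re e)%:C by rewrite RRe_real // gtr0_real.
  have e1 : 0 < complex.Re e by rewrite -ltcR -ee.
  have [N uN] := uc _ e1.
  exists (u N); exists N => // n /= Nn.
  by rewrite -ball_normE /= ee rnormE ltcR; exact: uN.
move=> /cvg_ex [l /cvgrPdist_lt ul]; exists l => e e0.
have [|N _ uN] := ul e%:C; first by rewrite ltcR.
by exists N => n Nn; have := uN n Nn; rewrite /= rnormE ltcR.
Qed.

End Completeness.

Section BoundedCharacters.
Variables (R : realType) (A : comCStarAlgType R[i]).

Lemma geometric_to0 (r c : R) : 0 <= r -> r < 1 -> 0 <= c ->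
  forall e, 0 < e -> exists N, c * r ^+ N < e.
Proof.
move=> r0 r1 c0 e e0.
have c1 : 0 < c + 1 by rewrite ltr_wpDl.
have : (fun n => r ^+ n) @ \oo --> (0 : R) by apply: cvg_expr; rewrite ger0_norm.
move=> /cvgrPdist_lt /(_ (e / (c + 1)) (divr_gt0 e0 c1)) [N _ h]; exists N.
have := h N (leqnn N); rewrite /= sub0r normrN ger0_norm ?exprn_ge0 //.
rewrite ltr_pdivlMr // mulrC; apply: le_lt_trans.
by rewrite ler_wpM2r ?exprn_ge0 // lerDl.
Qed.

Lemma rnorm_apow_le (b : A) n : rnorm (apow b n) <= rnorm (aone : A) * rnorm b ^+ n.
Proof.
elim: n => [|n IH]; first by rewrite expr0 mulr1.
rewrite apowS exprS mulrCA; apply: le_trans (rnorm_amul _ _) _.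
by rewrite ler_wpM2l ?rnorm_ge0.
Qed.

(** If |f(a)| > |a|, rescale to an element b with f(b) = 1 and |b| < 1. The sum l of
    the geometric series of b satisfies l = 1 + b l, and applying f gives 0 = 1. *)
Lemma character_le (f : A -> R[i]) a : character f -> rnorm (f a) <= rnorm a.
Proof.
move=> fc; rewrite leNgt; apply/negP => lt_a_fa.
have fa0 : f a != 0.
  apply: contraTneq lt_a_fa => ->; by rewrite rnorm0 -leNgt rnorm_ge0.
have fap : 0 < rnorm (f a) by apply: le_lt_trans lt_a_fa; exact: rnorm_ge0.
pose b := (f a)^-1 *: a.
have fb : f b = 1 by rewrite (characterZ fc) mulVf.
have b1 : rnorm b < 1.
  rewrite -(ltr_pM2l fap) mulr1; apply: le_lt_trans lt_a_fa.
  by rewrite -rnormZ /b scalerA divff // scale1r.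
pose c := rnorm (aone : A).
have c0 : 0 <= c by exact: rnorm_ge0.
have r0 : 0 <= rnorm b by exact: rnorm_ge0.
pose S n := \sum_(i < n) apow b i.
have S1 n : S n.+1 = aone + amul b (S n).
  rewrite /S big_ord_recl; congr (_ + _).
  elim: n => [|n IH]; last by rewrite !big_ord_recr /= star_amulDr IH.
  by rewrite !big_ord0 amulC; have := amulZl 0 0 b; rewrite !scale0r.
have Sdist N k : rnorm (S N - S (N + k)%N) * (1 - rnorm b) <=
    c * rnorm b ^+ N - c * rnorm b ^+ (N + k).
  elim: k => [|k IH]; first by rewrite addn0 !subrr rnorm0 mul0r.
  have -> : S N - S (N + k.+1)%N = (S N - S (N + k)%N) + - apow b (N + k).
    by rewrite addnS [S (N + k).+1]big_ord_recr /= opprD addrA.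
  apply: (@le_trans _ _ ((rnorm (S N - S (N + k)%N) + c * rnorm b ^+ (N + k)) *
    (1 - rnorm b))).
    apply: ler_wpM2r; first by rewrite subr_ge0 ltW.
    apply: le_trans (ler_rnormD _ _) _; rewrite lerD2l rnormN.
    exact: rnorm_apow_le.
  rewrite addnS exprS mulrDl; apply: le_trans (lerD IH (lexx _)) _.
  by rewrite le_eqVlt; apply/orP; left; apply/eqP; ring.
have [|l Sl] := @rnorm_cauchy_cvg R A S.
  move=> e e0; have e1 : 0 < e * (1 - rnorm b) by rewrite mulr_gt0 // subr_gt0.
  have [N hN] := geometric_to0 r0 b1 c0 e1.
  exists N => n /subnKC <-; rewrite -(@ltr_pM2r _ (1 - rnorm b)) ?subr_gt0 //.
  apply: le_lt_trans hN; apply: le_trans (Sdist _ _) _.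
  by rewrite lerBlDr lerDl mulr_ge0 // exprn_ge0.
have lfix : l = aone + amul b l.
  apply/eqP; rewrite -subr_eq0; apply/eqP/rnorm0_eq0/eqP.
  rewrite eq_le rnorm_ge0 andbT leNgt; apply/negP; set d := rnorm _ => d0.
  have [N hN] := Sl (d / 2) (divr_gt0 d0 (ltr0Sn _ 1)).
  have h0 := hN _ (leqnn N); have h1 := hN _ (leqnSn N).
  have : d <= rnorm (l - S N.+1) + rnorm (amul b (l - S N)).
    rewrite /d -[rnorm (amul _ _)]rnormN; apply: le_trans (ler_rnormD _ _).
    rewrite S1 star_amulBr !opprD opprK !addrA.
    by rewrite [X in _ <= rnorm (X + _)]addrAC subrK.
  have := rnorm_amul b (l - S N).
  have : rnorm b * rnorm (l - S N) <= rnorm (l - S N).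
    by rewrite ler_piMl ?rnorm_ge0 // ltW.
  lra.
have := congr1 f lfix; rewrite (characterD fc) (characterM fc) fb mul1r.
rewrite (character1 fc) => /eqP fl.
suff /eqP : 1 = 0 :> R[i] by rewrite oner_eq0.
by apply: (addIr (f l)); rewrite add0r -(eqP fl).
Qed.

End BoundedCharacters.

(** * The spectrum *)
Lemma ptcomp_continuous (T U V : topologicalType) (f : T -> U) (g : U -> V) :
  continuous f -> continuous g -> continuous (fun x => g (f x)).
Proof. by move=> cf cg x; apply: (@cvg_comp _ _ _ f g); [exact: cf|exact: cg]. Qed.

Lemma ptpair_continuous (T U V : topologicalType) (f : T -> U) (g : T -> V) :
  continuous f -> continuous g -> continuous (fun x => (f x, g x)).
Proof. by move=> cf cg x; exact: cvg_pair (cf x) (cg x). Qed.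

Lemma ptfst_continuous (T U : topologicalType) : continuous (@fst T U).
Proof. by move=> x; exact: cvg_fst. Qed.

Lemma ptsnd_continuous (T U : topologicalType) : continuous (@snd T U).
Proof. by move=> x; exact: cvg_snd. Qed.

Section PointwiseOperations.
Variables (C : numClosedFieldType) (T : topologicalType).
Implicit Types f g : T -> C.

Lemma ptadd_continuous f g : continuous f -> continuous g ->
  continuous (fun x => f x + g x).
Proof. by move=> cf cg x; apply: cvgD; [exact: cf|exact: cg]. Qed.

Lemma ptsub_continuous f g : continuous f -> continuous g ->
  continuous (fun x => f x - g x).
Proof. by move=> cf cg x; apply: cvgB; [exact: cf|exact: cg]. Qed.

Lemma ptmul_continuous f g : continuous f -> continuous g ->
  continuous (fun x => f x * g x).
Proof. by move=> cf cg x; apply: cvgM; [exact: cf|exact: cg]. Qed.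

Lemma ptconj_continuous f : continuous f -> continuous (fun x => (f x)^*).
Proof. by move=> cf; exact (@cfun_conj_subproof C T (@mk_cfun C T f cf)). Qed.

Lemma ptcst_continuous k : continuous (fun _ : T => k : C).
Proof. by move=> x; exact: cvg_cst. Qed.

Lemma approx_continuous f :
  (forall e, 0 < e -> exists2 g, continuous g & forall x, `|f x - g x| < e) ->
  continuous f.
Proof.
move=> fg x; apply/cvgrPdist_lt => e e0.
have [g cg fge] := fg (e / 3) (divr_gt0 e0 (ltr0Sn _ 2)).
have /cvgrPdist_lt /(_ _ (divr_gt0 e0 (ltr0Sn _ 2))) := cg x.
apply: filterS => y xy.
have -> : f x - f y = (f x - g x) + (g x - g y) + - (f y - g y) by ring.
have -> : e = e / 3 + e / 3 + e / 3 by field.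
apply: le_lt_trans (ler_normD _ _) _; rewrite normrN ltrD //.
by apply: le_lt_trans (ler_normD _ _) _; rewrite ltrD.
Qed.

Lemma closed_zero f : continuous f -> closed [set x | f x = 0].
Proof.
move=> cf; rewrite (_ : [set x | f x = 0] = f @^-1` [set 0]) //.
apply: preimage_closed => //.
exact/accessible_closed_set1/hausdorff_accessible/norm_hausdorff.
Qed.

Lemma open_neq0 f : continuous f -> open [set x | f x != 0].
Proof.
move=> cf; rewrite (_ : [set x | f x != 0] = ~` [set x | f x = 0]).
  by apply: closed_openC; exact: closed_zero.
by apply/seteqP; split=> x /= /eqP.
Qed.

End PointwiseOperations.

Section Spectrum.
Variables (C : numClosedFieldType) (A : comStarAlgType C).

Definition spectrum := set_type [set f : {ptws A -> C} | character f].

HB.instance Definition _ := Topological.on spectrum.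

Definition chi_val (chi : spectrum) : A -> C := \val chi.

Lemma chi_character chi : character (chi_val chi).
Proof. exact: (@set_valP _ [set f : {ptws A -> C} | character f]). Qed.

Definition mk_spectrum (f : A -> C) (fc : character f) : spectrum :=
  exist _ (f : {ptws A -> C}) (mem_set fc).

Lemma chi_mk (f : A -> C) (fc : character f) : chi_val (mk_spectrum fc) = f.
Proof. by []. Qed.

Lemma chi_inj chi psi : chi_val chi = chi_val psi -> chi = psi.
Proof. exact: val_inj. Qed.

Lemma chi_eval_continuous a : continuous (fun chi => chi_val chi a).
Proof.
move=> chi; apply: (@cvg_comp _ _ _ (fun chi : spectrum => \val chi)
  (fun f : {ptws A -> C} => f a)).
  exact: initial_continuous.
exact: ptws_eval_continuous.
Qed.

Lemma cvg_spectrum (F : set_system spectrum) (chi : spectrum) : Filter F ->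
  (forall a, (fun psi => chi_val psi a) @ F --> chi_val chi a) -> F --> chi.
Proof.
move=> FF h; apply: (@cvg_initial _ _ (fun psi : spectrum => \val psi)).
by apply: cvg_ptws => a; exact: h.
Qed.

Lemma closed_character : closed [set f : {ptws A -> C} | character f].
Proof.
have ev a : continuous (fun f : {ptws A -> C} => f a) by exact: ptws_eval_continuous.
have -> : [set f : {ptws A -> C} | character f] =
  \bigcap_(x in [set: C * A * A])
    ([set f | f (x.1.1 *: x.1.2 + x.2) - (x.1.1 * f x.1.2 + f x.2) = 0] `&`
     [set f | f aone - 1 = 0] `&`
     [set f | f (amul x.1.2 x.2) - f x.1.2 * f x.2 = 0] `&`
     [set f | f (star x.2) - (f x.2)^* = 0]).
  apply/seteqP; split=> [f fc [[k a] b] _ /=|f h].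
    by rewrite (characterD fc) (characterZ fc) (characterM fc) (character1 fc)
      (character_star fc) !subrr.
  have {}h k a b := h (k, a, b) Logic.I.
  split.
  - by move=> k a b; apply: subr0_eq; case: (h k a b) => -[[]].
  - by apply: subr0_eq; case: (h 0 0 0) => -[[]].
  - by move=> a b; apply: subr0_eq; case: (h 0 a b) => -[[]].
  - by move=> a; apply: subr0_eq; case: (h 0 0 a).
apply: closed_bigI => -[[k a] b] _ /=.
do ![apply: closedI]; apply: closed_zero.
- apply: ptsub_continuous; first exact: ev.
  by apply: ptadd_continuous; [apply: ptmul_continuous; [exact: ptcst_continuous|]|]; exact: ev.
- by apply: ptsub_continuous; [exact: ev|exact: ptcst_continuous].
- by apply: ptsub_continuous; [exact: ev|apply: ptmul_continuous; exact: ev].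
- by apply: ptsub_continuous; [exact: ev|apply: ptconj_continuous; exact: ev].
Qed.

End Spectrum.

Arguments chi_eval_continuous {C A} a.

(** * Gelfand duality *)
Section Gelfand.
Variables (R : realType) (A : comCStarAlgType R[i]).
Local Open Scope complex_scope.
Local Notation C := (R[i] : numClosedFieldType).

Lemma spectrum_compact : compact [set: spectrum A].
Proof.
apply: compact_set_type.
have /choice [K KP] : forall a : A, exists K : set C,
    compact K /\ forall z, rnorm z <= rnorm a -> K z.
  by move=> a; have [K cK KP] := disc_sub_compact (rnorm a); exists K.
have cK : compact [set f : {ptws A -> C} | forall a, K a (f a)].
  by apply: tychonoff => a; case: (KP a).
apply: subclosed_compact cK _; first exact: closed_character.
by move=> f fc a; case: (KP a) => _; apply; exact: character_le.
Qed.

Lemma Re_continuous : continuous (fun z : C => complex.Re z).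
Proof.
apply: rnorm_lipschitz => z w; rewrite -raddfB -lecR -rnormE.
exact: normc_ge_Re.
Qed.

Lemma Im_continuous : continuous (fun z : C => complex.Im z).
Proof.
apply: rnorm_lipschitz => z w.
rewrite -raddfB -(@ler_pXn2r _ 2) ?nnegrE ?normr_ge0 ?rnorm_ge0 //.
by rewrite real_normK ?num_real //; exact: Im_sqr_le.
Qed.

(** Transforms of elements on which every character is real. *)
Definition real_transforms : set (spectrum A -> R) :=
  [set s | exists a, forall chi, chi_val chi a = (s chi)%:C].

(** The sets where a nonnegative transform vanishing at chi is small form a filter.
    It converges to chi, because the squared modulus of psi(a) - chi(a) is a
    transform; so it refines the neighbourhoods of chi, which provides the
    functions separating chi from the complement of a neighbourhood. *)
Lemma real_transform_dense (f : spectrum A -> R) : continuous f ->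
  uniform_closure real_transforms f.
Proof.
apply: continuous_uniform_closure.
- exact: spectrum_compact.
- move=> k; exists (k%:C *: aone) => chi.
  by rewrite (characterZ (chi_character chi)) (character1 (chi_character chi)) mulr1.
- move=> g h [a ag] [b bh]; exists (a + b) => chi.
  by rewrite (characterD (chi_character chi)) ag bh rmorphD.
- move=> g h [a ag] [b bh]; exists (amul a b) => chi.
  by rewrite (characterM (chi_character chi)) ag bh rmorphM.
- move=> g [a ag]; have -> : g = (fun chi => complex.Re (chi_val chi a)).
    by apply/funext => chi; rewrite ag.
  move=> chi; apply: (@cvg_comp _ _ _ (fun chi : spectrum A => chi_val chi a : C)
    (fun z : C => complex.Re z)); [exact: chi_eval_continuous|exact: Re_continuous].
move=> chi.
pose bump a (psi : spectrum A) : R := rnorm (chi_val psi a - chi_val chi a) ^+ 2.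
pose F : set_system (spectrum A) := [set U | exists h, [/\ real_transforms h,
  forall y, 0 <= h y, h chi = 0 & exists2 d : R, 0 < d & forall y, h y < d -> U y]].
have FF : Filter F.
  split.
  - exists (cst 0); split => //; last by exists 1.
    by exists 0 => psi; rewrite (character0 (chi_character psi)).
  - move=> U V [g [[a ag] g0 gx [d d0 gU]]] [h [[b bh] h0 hx [e e0 hV]]].
    exists (fun psi => d^-1 * g psi + e^-1 * h psi); split.
    + exists ((d^-1)%:C *: a + (e^-1)%:C *: b) => psi.
      rewrite (characterD (chi_character psi)) !(characterZ (chi_character psi)).
      by rewrite ag bh rmorphD !rmorphM.
    + by move=> y; rewrite addr_ge0 // mulr_ge0 // invr_ge0 ltW.
    + by rewrite gx hx !mulr0 addr0.
    exists 1 => // y lt1; split.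
      apply: gU; rewrite -(ltr_pM2l (_ : 0 < d^-1)) ?invr_gt0 // mulVf ?gt_eqF //.
      by apply: le_lt_trans lt1; rewrite lerDl mulr_ge0 // invr_ge0 ltW.
    apply: hV; rewrite -(ltr_pM2l (_ : 0 < e^-1)) ?invr_gt0 // mulVf ?gt_eqF //.
    by apply: le_lt_trans lt1; rewrite lerDr mulr_ge0 // invr_ge0 ltW.
  - move=> U V UV [h [Sh h0 hx [d d0 hU]]]; exists h; split => //.
    by exists d => // y /hU /UV.
have Fchi : F --> chi.
  apply: cvg_spectrum => a; apply/cvgrPdist_lt => e e0.
  have ee : e = (complex.Re e)%:C by rewrite RRe_real // gtr0_real.
  have e1 : 0 < complex.Re e by rewrite -ltcR -ee.
  exists (bump a); split.
  - pose b := a - chi_val chi a *: aone; exists (amul (star b) b) => psi.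
    rewrite (characterM (chi_character psi)) (character_star (chi_character psi)).
    rewrite mulrC -normCK (characterB (chi_character psi)).
    rewrite (characterZ (chi_character psi)) (character1 (chi_character psi)) mulr1.
    by rewrite rnormE rmorphXn.
  - by move=> psi; exact: sqr_ge0.
  - by rewrite /bump subrr rnorm0 expr0n.
  exists (complex.Re e ^+ 2); first by rewrite exprn_gt0.
  move=> psi; rewrite /bump ltr_pXn2r ?nnegrE ?rnorm_ge0 ?ltW // => h.
  by rewrite /= ee distrC rnormE ltcR.
by move=> U /Fchi [h [Sh h0 hx hd]]; exists h.
Qed.

Lemma gelfand_dense (f : spectrum A -> C) : continuous f ->
  forall e : R, 0 < e ->
  exists a, forall chi, rnorm (f chi - chi_val chi a) <= e.
Proof.
move=> cf e e0; have e2 : 0 < e / 2 by rewrite divr_gt0.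
have [|g [a ag] fg] := real_transform_dense (f := fun chi => complex.Re (f chi)) _ e2.
  move=> chi; apply: (@cvg_comp _ _ _ f (fun z : C => complex.Re z));
  [exact: cf|exact: Re_continuous].
have [|h [b bh] fh] := real_transform_dense (f := fun chi => complex.Im (f chi)) _ e2.
  move=> chi; apply: (@cvg_comp _ _ _ f (fun z : C => complex.Im z));
  [exact: cf|exact: Im_continuous].
exists (a + 'i%C *: b) => chi.
rewrite (characterD (chi_character chi)) (characterZ (chi_character chi)) ag bh.
rewrite [f chi]complexE opprD addrACA -mulrBr -!rmorphB [leRHS]splitr.
apply: le_trans (ler_rnormD _ _) _; apply: lerD; first by rewrite rnorm_real.
suff i1 : rnorm ('i%C : R[i]) = 1 by rewrite rnormM i1 mul1r rnorm_real.
by rewrite /rnorm normc_def /= expr0n expr1n add0r sqrtr1.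
Qed.

Lemma gelfand_injective (a : A) : (forall chi, chi_val chi a = 0) -> a = 0.
Proof.
move=> a0; apply/eqP; apply: contraT => an0.
have [f fc] := exists_character an0; have := a0 (mk_spectrum fc).
rewrite chi_mk => ->; rewrite rnorm0 => /esym /rnorm0_eq0 ae0.
by rewrite ae0 eqxx in an0.
Qed.

Lemma rnorm_le_characters (a : A) (e : R) : 0 <= e ->
  (forall chi, rnorm (chi_val chi a) <= e) -> rnorm a <= e.
Proof.
move=> e0 ae; have [->|an0] := eqVneq a 0; first by rewrite rnorm0.
have [f fc <-] := exists_character an0; exact: (ae (mk_spectrum fc)).
Qed.

(** Approximations of f within 1 / (n + 1) form a Cauchy sequence in A, the norm
    being the supremum over the characters. *)
Lemma gelfand_surjective (f : spectrum A -> C) : continuous f ->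
  exists a, forall chi, f chi = chi_val chi a.
Proof.
move=> cf.
have e_gt0 n : 0 < n.+1%:R^-1 :> R by rewrite invr_gt0.
have [a fa] := choice (fun n => gelfand_dense cf (e_gt0 n)).
have small (e : R) : 0 < e -> exists N, forall n, (N <= n)%N -> n.+1%:R^-1 < e.
  move=> e0; exists (Num.bound e^-1) => n Nn.
  rewrite -[ltRHS]invrK ltf_pV2 ?posrE ?invr_gt0 ?ltr0n //.
  apply: lt_le_trans (archi_boundP _) _; first by rewrite invr_ge0 ltW.
  by rewrite ler_nat leqW.
have [|l al] := @rnorm_cauchy_cvg R A a.
  move=> e e0; have [N hN] := small (e / 2) (divr_gt0 e0 (ltr0Sn _ 1)).
  exists N => n Nn.
  apply: (@le_lt_trans _ _ (N.+1%:R^-1 + n.+1%:R^-1)); last first.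
    by rewrite [ltRHS]splitr ltrD // hN.
  apply: rnorm_le_characters => [|chi]; first by rewrite addr_ge0 ?ltW.
  rewrite (characterB (chi_character chi)).
  have -> : chi_val chi (a N) - chi_val chi (a n) =
    - (f chi - chi_val chi (a N)) + (f chi - chi_val chi (a n)).
    by rewrite opprB addrA subrK.
  by apply: le_trans (ler_rnormD _ _) _; rewrite rnormN lerD.
exists l => chi; apply: subr0_eq; apply/rnorm0_eq0/eqP.
rewrite eq_le rnorm_ge0 andbT leNgt; apply/negP; set d := rnorm _ => d0.
have d2 : 0 < d / 2 by rewrite divr_gt0.
have [N hN] := small _ d2; have [M hM] := al _ d2.
pose n := maxn N M; have h1 := hN n (leq_maxl _ _); have h2 := hM n (leq_maxr _ _).
have hd : d <= rnorm (f chi - chi_val chi (a n)) + rnorm (chi_val chi (l - a n)).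
  rewrite /d (characterB (chi_character chi)) -[rnorm (chi_val chi l - _)]rnormN opprB.
  by apply: le_trans (ler_rnormD _ _); rewrite addrA subrK.
have h3 := fa n chi.
have h4 : rnorm (chi_val chi (l - a n)) <= rnorm (l - a n).
  by apply: character_le; exact: chi_character.
by have := le_lt_trans (le_trans hd (lerD h3 h4)) (ltrD h1 h2); rewrite -splitr ltxx.
Qed.

End Gelfand.

(** * Limits of quotients and unit complex numbers *)
Lemma inj_surj_bijective (S T : Type) (f : S -> T) :
  injective f -> (forall y, exists x, f x = y) -> bijective f.
Proof.
move=> fi /choice [g gf]; exists g => // x; exact/fi/gf.
Qed.

Section QuotientLimits.
Variables (C : numClosedFieldType) (T : topologicalType).
Implicit Types (f N D : T -> C) (p : T).

(** The form in which continuity is checked in all bundle charts: the chosen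
    characters p_x need not depend continuously on x, but products such as the
    conjugate of p_x(xi) times p_x(eta) do, and clearing a denominator of this
    kind turns a function of interest into another one. *)
Lemma quotient_cvg f N D p : N @ p --> N p -> D @ p --> D p -> D p != 0 ->
  (forall w, f w * D w = N w) -> f @ p --> f p.
Proof.
move=> Np Dp Dp0 fD.
have ND : (fun w => N w / D w) @ p --> f p.
  rewrite -[f p](mulfK Dp0) fD; apply: cvgM => //; exact: cvgV.
apply: cvg_trans ND; apply: near_eq_cvg.
have D0 : \forall w \near p, D w != 0 by exact: (cvgr_neq0 _ Dp Dp0).
by apply: (filterS _ D0) => w Dw; rewrite -fD mulfK.
Qed.

(** |f(w) - f(p)| f(p) <= |f(w)^2 - f(p)^2|. *)
Lemma cvg_sqr f p : (forall w, 0 <= f w) -> f p != 0 ->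
  (fun w => f w ^+ 2) @ p --> f p ^+ 2 -> f @ p --> f p.
Proof.
move=> f0 fp0 f2; have fp : 0 < f p by rewrite lt_neqAle eq_sym fp0 f0.
apply/cvgrPdist_lt => e e0.
have /cvgrPdist_lt /(_ _ (mulr_gt0 e0 fp)) := f2.
apply: filterS => w; rewrite subr_sqr normrM => h.
rewrite -(ltr_pM2r fp); apply: le_lt_trans h; rewrite ler_wpM2l //.
by rewrite ger0_norm ?addr_ge0 // lerDl.
Qed.

End QuotientLimits.

Section CircleFacts.
Variable C : numClosedFieldType.

Lemma circle_val_inv (z : circle C) : \val (z^-1)%g = (\val z)^*.
Proof.
have zz : (\val z)^* * \val z = 1 by rewrite mulrC -normCK circle_norm expr1n.
by apply: (mulIf (circle_neq0 z)); rewrite zz /= mulVf ?circle_neq0.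
Qed.

Lemma circle_valM (z w : circle C) : \val (z * w)%g = \val z * \val w.
Proof. by []. Qed.

Lemma circle_conjM (z : circle C) : (\val z)^* * \val z = 1.
Proof. by rewrite -circle_val_inv /= mulVf ?circle_neq0. Qed.

Fact direction_subproof (z : C) : z != 0 -> `|z / `|z| | = 1.
Proof. by move=> z0; rewrite normrM normfV normr_id divff ?normr_eq0. Qed.

Definition direction (z : C) : circle C :=
  if pselect (z != 0) is left z0 then mk_circle (direction_subproof z0) else 1%g.

Lemma val_direction z : z != 0 -> \val (direction z) = z / `|z|.
Proof. by rewrite /direction; case: pselect. Qed.

Lemma directionM (w : circle C) z : z != 0 ->
  direction (\val w * z) = (w * direction z)%g.
Proof.
move=> z0; apply: val_inj; rewrite circle_valM !val_direction ?mulf_neq0 ?circle_neq0 //.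
by rewrite normrM circle_norm mul1r mulrA.
Qed.

Lemma direction_mul (z : C) : \val (direction z) * `|z| = z.
Proof.
have [->|z0] := eqVneq z 0; first by rewrite normr0 mulr0.
by rewrite val_direction // divfK // normr_eq0.
Qed.

Lemma direction_cvg (T : topologicalType) (f : T -> C) (t : T) :
  f @ t --> f t -> f t != 0 ->
  (fun s => \val (direction (f s))) @ t --> \val (direction (f t)).
Proof.
move=> ft ft0; apply: (@quotient_cvg _ _ _ f (fun s => `|f s|)) => //.
- exact: cvg_norm.
- by rewrite normr_eq0.
- by move=> s; exact: direction_mul.
Qed.

End CircleFacts.

(** * The circle action on the spectrum and the base space *)
Section Reconstruction.
Variables (C : numClosedFieldType) (A : comCStarAlgType C).
Variable gamma : circle_action A.

Fact rotate_subproof (z : circle C) (chi : spectrum A) :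
  character (chi_val chi \o gamma z^-1%g).
Proof.
have cc := chi_character chi; split.
- by move=> k a b /=; rewrite gauge_lin (character_lin cc).
- by rewrite /= gauge_aone (character1 cc).
- by move=> a b /=; rewrite gauge_amul (characterM cc).
- by move=> a /=; rewrite gauge_star (character_star cc).
Qed.

Definition rotate z chi : spectrum A := mk_spectrum (rotate_subproof z chi).

Lemma rotateE z chi a : chi_val (rotate z chi) a = chi_val chi (gamma z^-1%g a).
Proof. by []. Qed.

Lemma rotate1 chi : rotate 1%g chi = chi.
Proof. by apply: chi_inj; apply/funext => a; rewrite rotateE invg1 gauge1. Qed.

Lemma rotateM z w chi : rotate (z * w)%g chi = rotate z (rotate w chi).
Proof. by apply: chi_inj; apply/funext => a; rewrite !rotateE invgM gaugeM. Qed.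

Lemma rotate_base z chi (b : gauge_base gamma) :
  chi_val (rotate z chi) (\val b) = chi_val chi (\val b).
Proof. by rewrite rotateE gauge_baseP expr0z scale1r. Qed.

Lemma rotate_module z chi (xi : gauge_module gamma) :
  chi_val (rotate z chi) (\val xi) = (\val z)^* * chi_val chi (\val xi).
Proof.
rewrite rotateE gauge_moduleP expr1z (characterZ (chi_character chi)).
by rewrite circle_val_inv.
Qed.

Lemma chi_dot chi (xi eta : gauge_module gamma) :
  chi_val chi (\val (gauge_dot xi eta)) =
  (chi_val chi (\val xi))^* * chi_val chi (\val eta).
Proof.
have cc := chi_character chi.
by rewrite /= (characterM cc) (character_star cc).
Qed.

(** The base space, as a space of restricted characters rather than as an orbit
    space or the spectrum of the degree zero subalgebra: it is compact as an
    image of the spectrum, and Hausdorff as a subspace of a product. *)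
Definition base_space := set_type [set f : {ptws gauge_base gamma -> C} |
  exists chi : spectrum A, f = (fun b => chi_val chi (\val b))].

HB.instance Definition _ := Topological.on base_space.

Definition base_eval (x : base_space) (b : gauge_base gamma) : C := \val x b.

Definition restr (chi : spectrum A) : base_space :=
  exist _ (_ : {ptws gauge_base gamma -> C}) (mem_set (ex_intro _ chi erefl)).

Lemma base_evalE chi b : base_eval (restr chi) b = chi_val chi (\val b).
Proof. by []. Qed.

Lemma base_space_inj x y : base_eval x = base_eval y -> x = y.
Proof. by move=> xy; apply: val_inj; exact: xy. Qed.

Lemma base_eval_continuous b : continuous (base_eval ^~ b).
Proof.
move=> x; apply: (@cvg_comp _ _ _ (fun x : base_space => \val x)
  (fun f : {ptws gauge_base gamma -> C} => f b)).
  exact: initial_continuous.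
exact: ptws_eval_continuous.
Qed.

Lemma cvg_base_space (T : topologicalType) (f : T -> base_space) (p : T) :
  (forall b, (fun t => base_eval (f t) b) @ p --> base_eval (f p) b) ->
  f @ p --> f p.
Proof.
move=> h; apply: (@cvg_initial _ _ (fun y : base_space => \val y)).
by apply: cvg_ptws => b; exact: h.
Qed.

Lemma restr_continuous : continuous restr.
Proof.
by move=> chi; apply: cvg_base_space => b; exact: chi_eval_continuous.
Qed.

Lemma restr_rotate z chi : restr (rotate z chi) = restr chi.
Proof. by apply: base_space_inj; apply/funext => b; exact: rotate_base. Qed.

Lemma restr_surj x : exists chi, restr chi = x.
Proof.
have [chi chix] := @set_valP _ [set f : {ptws gauge_base gamma -> C} |
  exists chi : spectrum A, f = (fun b => chi_val chi (\val b))] x.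
by exists chi; apply: val_inj; rewrite /= -chix.
Qed.

(** The character p_x of the introduction; no continuity in x is claimed. *)
Definition sect (x : base_space) : spectrum A := sval (cid (restr_surj x)).

Lemma restr_sect x : restr (sect x) = x.
Proof. exact: (svalP (cid (restr_surj x))). Qed.

Lemma sect_base x b : chi_val (sect x) (\val b) = base_eval x b.
Proof. by rewrite -base_evalE restr_sect. Qed.

Lemma sect_dot x xi eta : (chi_val (sect x) (\val xi))^* *
  chi_val (sect x) (\val eta) = base_eval x (gauge_dot xi eta).
Proof. by rewrite -chi_dot sect_base. Qed.

Lemma base_space_hausdorff : hausdorff_space base_space.
Proof.
move=> x y xy; apply: val_inj.
have hp : hausdorff_space {ptws gauge_base gamma -> C}.
  by apply: hausdorff_product => b; exact: norm_hausdorff.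
apply: hp => U V Ux Vy.
have [u [Uu Vu]] := xy _ _ (@initial_continuous _ _ (fun x : base_space => \val x) x U Ux)
  (@initial_continuous _ _ (fun x : base_space => \val x) y V Vy).
by exists (\val u).
Qed.

Lemma base_space_compact : compact [set: spectrum A] -> compact [set: base_space].
Proof.
move=> cs; rewrite (_ : [set: base_space] = restr @` [set: spectrum A]).
  apply: continuous_compact => //; apply: continuous_subspaceT.
  exact: restr_continuous.
by rewrite predeqE => x; split => // _; have [chi <-] := restr_surj x; exists chi.
Qed.

End Reconstruction.

Arguments base_eval_continuous {C A gamma} b.

(** * Orbits are the fibres of restriction *)
Section Generation.
Variables (C : numClosedFieldType) (A : comCStarAlgType C).
Variable gamma : circle_action A.
Hypothesis Egen : cstar_generated (spectral_subspace gamma 1) = [set: A].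
Hypothesis chi_le : forall (chi : spectrum A) a, `|chi_val chi a| <= `|a|.

Lemma generated_ind (S : set A) : cstar_subalgebra S ->
  (forall xi : gauge_module gamma, S (\val xi)) -> forall a, S a.
Proof.
move=> cS ES a; have : cstar_generated (spectral_subspace gamma 1) a by rewrite Egen.
move=> /(_ S); apply; split => // e Ee; exact: (ES (mk_module Ee)).
Qed.

Lemma chi_continuous (chi : spectrum A) : continuous (chi_val chi).
Proof.
move=> a; apply/cvgrPdist_lt => e e0.
have /cvgrPdist_lt /(_ _ e0) : (fun b : A => b) @ a --> a by exact: cvg_id.
apply: filterS => b; apply: le_lt_trans.
by rewrite -(characterB (chi_character chi)).
Qed.

(** The kernel of chi is a C*-subalgebra. It does not contain the unit, so it does
    not contain the generating subspace. *)
Lemma module_nonzero (chi : spectrum A) :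
  exists xi : gauge_module gamma, chi_val chi (\val xi) != 0.
Proof.
have cc := chi_character chi; apply: contrapT => /forallNP xi0.
suff : forall a, chi_val chi a = 0.
  by move=> /(_ aone) /eqP; rewrite (character1 cc) oner_eq0.
apply: (@generated_ind [set a | chi_val chi a = 0]); last first.
  by move=> xi; apply: contrapT => /eqP /xi0.
split => /=.
- exact: character0.
- by move=> k a b a0 b0; rewrite (character_lin cc) a0 b0 mulr0 addr0.
- by move=> a b a0 b0; rewrite (characterM cc) a0 mul0r.
- by move=> a a0; rewrite (character_star cc) a0 conjC0.
- by apply: closed_zero; exact: chi_continuous.
Qed.

Lemma character_module_inj (chi psi : spectrum A) :
  (forall xi : gauge_module gamma, chi_val chi (\val xi) = chi_val psi (\val xi)) ->
  chi = psi.
Proof.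
have [cc cp] := (chi_character chi, chi_character psi).
move=> E; apply: chi_inj; apply/funext => a; apply: subr0_eq.
apply: (@generated_ind [set a | chi_val chi a - chi_val psi a = 0]); last first.
  by move=> xi; rewrite /= E subrr.
split => /=.
- by rewrite !character0 // subrr.
- move=> k b c /subr0_eq b0 /subr0_eq c0.
  by rewrite !character_lin // b0 c0 subrr.
- by move=> b c /subr0_eq b0 /subr0_eq c0; rewrite !characterM // b0 c0 subrr.
- by move=> b /subr0_eq b0; rewrite !character_star // b0 subrr.
- by apply: closed_zero; apply: ptsub_continuous; exact: chi_continuous.
Qed.

(** With e such that psi(e) is nonzero, |chi(e)| = |psi(e)| since e* e has degree 0,
    and comparing both characters on e* xi shows that chi is psi(e) / chi(e)
    conjugated times psi on all xi of degree one. *)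
Lemma restr_eq_rotate (chi psi : spectrum A) :
  restr gamma chi = restr gamma psi -> exists z, chi = rotate gamma z psi.
Proof.
move=> E.
have {}E xi eta : (chi_val chi (\val (xi : gauge_module gamma)))^* *
    chi_val chi (\val (eta : gauge_module gamma)) =
  (chi_val psi (\val xi))^* * chi_val psi (\val eta).
  by rewrite -!chi_dot -!base_evalE E.
have [e pe] := module_nonzero psi.
have nce : `|chi_val chi (\val e)| = `|chi_val psi (\val e)|.
  by apply/eqP; rewrite -(@eqrXn2 _ 2) // !normCK mulrC E mulrC.
have ce : chi_val chi (\val e) != 0 by rewrite -normr_eq0 nce normr_eq0.
have w1 : `|chi_val psi (\val e) / chi_val chi (\val e)| = 1.
  by rewrite normrM normfV nce divff ?normr_eq0.
exists (mk_circle w1); apply: character_module_inj => xi.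
rewrite rotate_module -[\val (mk_circle w1)]/(_ / _).
apply: (mulfI (_ : (chi_val chi (\val e))^* != 0)); first by rewrite conjC_eq0.
by rewrite E rmorphM fmorphV mulrCA mulrA mulfVK // conjC_eq0.
Qed.

Lemma rotate_free z w (chi : spectrum A) :
  rotate gamma z chi = rotate gamma w chi -> z = w.
Proof.
move=> E; have [e ce] := module_nonzero chi.
have := congr1 (fun psi => chi_val psi (\val e)) E.
rewrite /= -!/(chi_val (rotate _ _ _) _) !rotate_module => /(mulIf ce).
by move/(can_inj conjCK) => zw; apply: val_inj.
Qed.

Local Notation X := (base_space gamma).

Lemma phase_ex chi : exists z, chi = rotate gamma z (sect (restr gamma chi)).
Proof. by apply: restr_eq_rotate; rewrite restr_sect. Qed.

Definition phase (chi : spectrum A) : circle C := sval (cid (phase_ex chi)).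

Lemma rotate_phase chi : rotate gamma (phase chi) (sect (restr gamma chi)) = chi.
Proof. by rewrite -(svalP (cid (phase_ex chi))). Qed.

Lemma phase_rotate z chi : phase (rotate gamma z chi) = (z * phase chi)%g.
Proof.
apply: (@rotate_free _ _ (sect (restr gamma chi))).
by rewrite rotateM rotate_phase -[RHS]rotate_phase restr_rotate.
Qed.

Lemma phase_sect (x : X) : phase (sect x) = 1%g.
Proof.
apply: (@rotate_free _ _ (sect x)).
by rewrite rotate1 -[RHS]rotate_phase restr_sect.
Qed.

Lemma phase_module chi (xi : gauge_module gamma) : chi_val chi (\val xi) =
  (\val (phase chi))^* * chi_val (sect (restr gamma chi)) (\val xi).
Proof. by rewrite -{1}(rotate_phase chi) rotate_module. Qed.

End Generation.

(** * The Hermitian line bundle *)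
Section Family.
Variables (C : numClosedFieldType) (A : comCStarAlgType C).
Variable gamma : circle_action A.
Local Notation X := (base_space gamma).
Local Notation E := (gauge_module gamma).

Definition line_fiber (x : X) : lmodType C := C^o.

Definition sect_val (xi : E) (x : X) : C := chi_val (sect x) (\val xi).

Lemma sect_val_dot xi eta x :
  (sect_val xi x)^* * sect_val eta x = base_eval x (gauge_dot xi eta).
Proof. exact: sect_dot. Qed.

(** The scalar product of the section given by xi with the vector p. For unit
    vectors it is the conjugate of the value at xi of the character that the
    vector stands for, which explains why these functions generate the right
    topology. *)
Definition line_coord (p : {x : X & line_fiber x}) (xi : E) : C :=
  (projT2 p : C) * (sect_val xi (projT1 p))^*.

Definition line_embedding (p : {x : X & line_fiber x}) : X * {ptws E -> C} :=
  (projT1 p, line_coord p).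

Definition gauge_family : vector_family C X :=
  @VectorFamily C X line_fiber (Topological.class (initial_topology line_embedding)).

Lemma cvg_total (T : topologicalType) (f : T -> total_space gauge_family) (p : T) :
  (fun t => bundle_proj (f t)) @ p --> bundle_proj (f p) ->
  (forall xi, (fun t => line_coord (f t) xi) @ p --> line_coord (f p) xi) ->
  f @ p --> f p.
Proof.
move=> f1 f2; apply: (@cvg_initial _ _ line_embedding).
have {}f2 : (fun t => line_coord (f t) : {ptws E -> C}) @ p -->
    (line_coord (f p) : {ptws E -> C}).
  by apply: cvg_ptws => xi; exact: f2.
exact: cvg_pair f1 f2.
Qed.

Lemma line_embedding_continuous :
  continuous (line_embedding : total_space gauge_family -> _).
Proof. exact: (@initial_continuous _ _ line_embedding). Qed.

Lemma gauge_proj_continuous : continuous (@bundle_proj C X gauge_family).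
Proof.
move=> p; apply: (@cvg_comp _ _ _ (line_embedding : total_space gauge_family -> _) fst).
  exact: line_embedding_continuous.
exact: cvg_fst.
Qed.

Lemma line_coord_continuous xi :
  continuous (line_coord ^~ xi : total_space gauge_family -> C).
Proof.
move=> p; apply: (@cvg_comp _ _ _ (fun p : total_space gauge_family =>
   (line_embedding p).2) (fun f : {ptws E -> C} => f xi)); last first.
  exact: ptws_eval_continuous.
apply: (@cvg_comp _ _ _ (line_embedding : total_space gauge_family -> _) snd).
  exact: line_embedding_continuous.
exact: cvg_snd.
Qed.

End Family.

Arguments line_coord_continuous {C A gamma} xi.

Section Bundle.
Variables (C : numClosedFieldType) (A : comCStarAlgType C).
Variable gamma : circle_action A.
Hypothesis Egen : cstar_generated (spectral_subspace gamma 1) = [set: A].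
Hypothesis chi_le : forall (chi : spectrum A) a, `|chi_val chi a| <= `|a|.
Local Notation X := (base_space gamma).
Local Notation E := (gauge_module gamma).

Definition nonvanishing (e : E) : set X :=
  [set x | base_eval x (gauge_dot e e) != 0].

Lemma nonvanishing_open e : open (nonvanishing e).
Proof. by apply: open_neq0; exact: base_eval_continuous. Qed.

Lemma nonvanishingP e x : nonvanishing e x <-> sect_val e x != 0.
Proof.
by rewrite /nonvanishing /= -sect_val_dot mulf_eq0 conjC_eq0 orbb.
Qed.

Lemma nonvanishing_ex x : exists2 e, open_nbhs x (nonvanishing e) & sect_val e x != 0.
Proof.
have [e ex] := module_nonzero Egen chi_le (sect x).
by exists e => //; split; [exact: nonvanishing_open|exact/nonvanishingP].
Qed.

(** Over the set where p_y(e) is nonzero the coordinate of e is a chart. That the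
    inverse chart is continuous comes down to the other coordinates being the
    coordinate of e times p_y(e* xi) / p_y(e* e), up to conjugation. *)
Lemma gauge_locally_trivial (x : X) : exists2 U : set X, open_nbhs x U &
  exists h : forall y, fiber (gauge_family gamma) y -> C,
    (forall y, U y -> scalar (h y)) /\
    homeomorphism_on (@bundle_proj C X (gauge_family gamma) @^-1` U) (U `*` setT)
      (fun p => (bundle_proj p, h (bundle_proj p) (bundle_vec p))).
Proof.
have [e xe _] := nonvanishing_ex x; exists (nonvanishing e) => //.
exists (fun y v => (v : C) * (sect_val e y)^*); split.
  by move=> y _ k u v /=; rewrite mulrDl -mulrA.
split.
  apply: continuous_subspaceT; apply: ptpair_continuous.
    exact: gauge_proj_continuous.
  exact: (line_coord_continuous e).
exists (fun q => @total_pt C X (gauge_family gamma) q.1 (q.2 / (sect_val e q.1)^* : C^o)).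
have ev eta : continuous (fun q : X * C => base_eval q.1 eta).
  apply: (@ptcomp_continuous _ _ _ (fst : X * C -> X) (fun x : X => base_eval x eta)).
    exact: ptfst_continuous.
  exact: base_eval_continuous.
split.
- apply: continuous_in_subspaceT => -[y t] /set_mem [/= Uy _].
  have y0 : sect_val e y != 0 by apply/nonvanishingP.
  apply: cvg_total; first exact: cvg_fst.
  move=> xi; rewrite /line_coord /=.
  apply: (@quotient_cvg _ _ _ (fun q : X * C => q.2 * base_eval q.1 (gauge_dot xi e))
     (fun q : X * C => base_eval q.1 (gauge_dot e e))).
  + apply: ptmul_continuous; first exact: ptsnd_continuous.
    exact: ev.
  + exact: ev.
  + exact: Uy.
  + move=> [z s] /=; rewrite -!sect_val_dot.
    have [->|z0] := eqVneq (sect_val e z) 0; first by rewrite !mulr0.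
    by field; rewrite conjC_eq0.
- by move=> p Up; split.
- by move=> [y t] [Uy _].
- move=> [y v] /set_mem /= /nonvanishingP y0; rewrite /bundle_vec /bundle_proj /=.
  by rewrite mulfK // conjC_eq0.
- move=> [y t] /set_mem [/= /nonvanishingP y0 _]; rewrite /bundle_vec /bundle_proj /=.
  by rewrite divfK // conjC_eq0.
Qed.

Definition gauge_line : line_bundle C X :=
  LineBundle (@gauge_proj_continuous C A gamma) gauge_locally_trivial.

Definition gauge_hdot (x : X) (u v : fiber gauge_line x) : C := (u : C)^* * (v : C).

Lemma gauge_hdot_linear x (u : fiber gauge_line x) : scalar (gauge_hdot u).
Proof. by move=> k v w; rewrite /gauge_hdot mulrDr mulrCA. Qed.

Lemma gauge_hdot_conj x (u v : fiber gauge_line x) :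
  gauge_hdot v u = (gauge_hdot u v)^*.
Proof. by rewrite /gauge_hdot rmorphM /= conjCK mulrC. Qed.

Lemma gauge_hdot_gt0 x (u : fiber gauge_line x) : u != 0 -> 0 < gauge_hdot u u.
Proof. by move=> u0; rewrite /gauge_hdot mulrC mul_conjC_gt0. Qed.

Lemma gauge_hdot_continuous :
  continuous ((fun w => gauge_hdot (projT2 w).1 (projT2 w).2) :
    initial_topology (@fiber_square_incl C X gauge_line) -> C).
Proof.
set incl := @fiber_square_incl C X gauge_line.
have incl_cont : continuous (incl : initial_topology incl -> _).
  exact: initial_continuous.
have c1 := ptcomp_continuous incl_cont (@ptfst_continuous _ _).
have c2 := ptcomp_continuous incl_cont (@ptsnd_continuous _ _).
move=> w; have [e xe e0] := nonvanishing_ex (projT1 w).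
have lc := line_coord_continuous e.
apply: (@quotient_cvg _ (initial_topology incl) _
  (fun w => (line_coord (incl w).1 e)^* * line_coord (incl w).2 e)
  (fun w => base_eval (bundle_proj (incl w).1) (gauge_dot e e))).
- apply: (@ptmul_continuous _ (initial_topology incl)).
    apply: ptconj_continuous; exact: (ptcomp_continuous c1 lc).
  exact: (ptcomp_continuous c2 lc).
- have cp := ptcomp_continuous c1 (@gauge_proj_continuous _ _ gamma).
  exact: (ptcomp_continuous cp (base_eval_continuous _)).
- by case: xe.
- move=> [y [u v]]; rewrite /incl /fiber_square_incl /line_coord /gauge_hdot /=.
  by rewrite -sect_val_dot rmorphM /= conjCK; ring.
Qed.

Definition gauge_hermitian : hermitian_line_bundle C X :=
  HermitianLineBundle gauge_hdot_linear gauge_hdot_conj gauge_hdot_gt0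
    gauge_hdot_continuous.

End Bundle.

(** * The circle bundle *)
Section CircleBundle.
Variables (C : numClosedFieldType) (A : comCStarAlgType C).
Variable gamma : circle_action A.
Hypothesis Egen : cstar_generated (spectral_subspace gamma 1) = [set: A].
Hypothesis chi_le : forall (chi : spectrum A) a, `|chi_val chi a| <= `|a|.
Local Notation X := (base_space gamma).
Local Notation E := (gauge_module gamma).
Local Notation L := (gauge_hermitian Egen chi_le).
Local Notation P := (circle_bundle L).
Local Notation proj := (@circle_bundle_proj C X L).

Fact circle_vec_subproof (p : P) : `|circle_bundle_vec p : C| = 1.
Proof.
have h : (circle_bundle_vec p : C)^* * circle_bundle_vec p = 1.
  exact: (@set_valP _ [set p : total_space L | hdot (bundle_vec p) (bundle_vec p) = 1] p).
apply/eqP; rewrite -(@pexpr_eq1 _ _ 2) //.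
by rewrite normCK mulrC h.
Qed.

Definition circle_vec (p : P) : circle C := mk_circle (circle_vec_subproof p).

Fact circle_point_subproof (x : X) (z : circle C) :
  @hdot C X L x (\val z : C^o) (\val z : C^o) = 1.
Proof. exact: circle_conjM. Qed.

Definition circle_point (x : X) (z : circle C) : P :=
  exist _ (@total_pt C X L x (\val z : C^o)) (mem_set (circle_point_subproof x z)).

Lemma proj_circle_point x z : proj (circle_point x z) = x. Proof. by []. Qed.

Lemma vec_circle_point x z : circle_vec (circle_point x z) = z.
Proof. exact: val_inj. Qed.

Lemma circle_pointK p : circle_point (proj p) (circle_vec p) = p.
Proof. by apply: val_inj; case: p => -[x v] ?. Qed.

Lemma act_circle_point z x w :
  circle_bundle_act L z (circle_point x w) = circle_point x (z * w)%g.
Proof. exact: val_inj. Qed.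

Definition circle_coord (p : P) (xi : E) : C :=
  (\val (circle_vec p)) * (sect_val xi (proj p))^*.

Lemma proj_continuous : continuous proj.
Proof.
exact: (@ptcomp_continuous _ _ _ (fun p : P => \val p : total_space L)
  (@bundle_proj C X L) (@initial_continuous _ _ _) (@gauge_proj_continuous _ _ gamma)).
Qed.

Lemma circle_coord_continuous xi : continuous (fun p : P => circle_coord p xi).
Proof.
exact: (@ptcomp_continuous _ _ _ (fun p : P => \val p : total_space L)
  (fun q => line_coord q xi) (@initial_continuous _ _ _) (line_coord_continuous xi)).
Qed.

Lemma cvg_circle_bundle (T : topologicalType) (f : T -> P) (t : T) :
  (fun s => proj (f s)) @ t --> proj (f t) ->
  (forall xi, (fun s => circle_coord (f s) xi) @ t --> circle_coord (f t) xi) ->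
  f @ t --> f t.
Proof.
move=> f1 f2; apply: (@cvg_initial _ _ (fun p : P => \val p : total_space L)).
exact: (@cvg_total _ _ gamma T (fun s => \val (f s)) t).
Qed.

Lemma circle_val_continuous : continuous (fun z : circle C => \val z).
Proof. exact: initial_continuous. Qed.

Lemma cvg_circle (T : topologicalType) (f : T -> circle C) (t : T) :
  (fun s => \val (f s)) @ t --> \val (f t) -> f @ t --> f t.
Proof. by move=> ft; apply: (@cvg_initial _ _ (fun z : circle C => \val z)). Qed.

Lemma act_continuous :
  continuous (fun zp : circle C * P => circle_bundle_act L zp.1 zp.2).
Proof.
move=> zp; apply: cvg_circle_bundle.
  exact: (@ptcomp_continuous _ _ _ (snd : circle C * P -> P) proj
    (@ptsnd_continuous _ _) proj_continuous).
move=> xi.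
have -> : (fun s : circle C * P => circle_coord (circle_bundle_act L s.1 s.2) xi) =
    (fun s => \val s.1 * circle_coord s.2 xi).
  by apply/funext => -[z p]; rewrite /circle_coord mulrA.
have -> : circle_coord (circle_bundle_act L zp.1 zp.2) xi = \val zp.1 * circle_coord zp.2 xi.
  by rewrite /circle_coord mulrA.
have c1 := ptcomp_continuous (@ptfst_continuous (circle C) P) circle_val_continuous.
have c2 := ptcomp_continuous (@ptsnd_continuous (circle C) P) (@circle_coord_continuous xi).
exact: (@ptmul_continuous _ _ _ _ c1 c2 zp).
Qed.

Lemma circle_coord_neq0 e p : nonvanishing e (proj p) -> circle_coord p e != 0.
Proof.
by move=> /nonvanishingP e0; rewrite mulf_neq0 ?circle_neq0 // conjC_eq0.
Qed.

Lemma direction_circle_coord e p : nonvanishing e (proj p) ->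
  (direction (circle_coord p e) * direction (sect_val e (proj p)))%g = circle_vec p.
Proof.
move=> ep; have /nonvanishingP e0 := ep; apply: val_inj; rewrite circle_valM.
rewrite !val_direction ?circle_coord_neq0 //.
set s := sect_val e (proj p) in e0 *.
have ns : `|s| != 0 by rewrite normr_eq0.
rewrite /circle_coord -/s normrM circle_norm norm_conjC mul1r.
have sn : s^* * s = `|s| ^+ 2 by rewrite mulrC -normCK.
by rewrite mulrACA -[X in X * _]mulrA sn -expr2 exprVn mulfK // expf_neq0.
Qed.

(** The chart normalizes the coordinate of e. Its inverse needs the continuity of
    |p_y(e)| in y, the square root of the continuous function p_y(e* e). *)
Lemma circle_bundle_trivial (x : X) : exists2 U : set X, open_nbhs x U &
  exists2 h : P -> circle C,
    homeomorphism_on (proj @^-1` U) (U `*` setT) (fun p => (proj p, h p)) &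
    forall z p, U (proj p) -> h (circle_bundle_act L z p) = (z * h p)%g.
Proof.
have [e xe _] := nonvanishing_ex Egen chi_le x; exists (nonvanishing e) => //.
have dir_cvg (p : P) : nonvanishing e (proj p) ->
    (fun q => direction (circle_coord q e)) @ p --> direction (circle_coord p e).
  move=> ep; apply: (@cvg_circle _ (fun q => direction (circle_coord q e))).
  by apply: direction_cvg; [exact: circle_coord_continuous|exact: circle_coord_neq0].
exists (fun p => direction (circle_coord p e)); last first.
  move=> z p pe; rewrite -directionM ?circle_coord_neq0 //.
  by rewrite /circle_coord mulrA.
split.
  apply: continuous_in_subspaceT => p /set_mem pe.
  exact: (cvg_pair (@proj_continuous p) (dir_cvg p pe)).
exists (fun q => circle_point q.1 (q.2 * direction (sect_val e q.1))%g); split.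
- apply: continuous_in_subspaceT => -[y w] /set_mem [/= ye _].
  apply: (@cvg_circle_bundle _ (fun q : X * circle C =>
    circle_point q.1 (q.2 * direction (sect_val e q.1))%g)).
    exact: cvg_fst.
  move=> xi.
  have F_cvg : (fun x => \val (direction (sect_val e x)) * (sect_val xi x)^*) @ y -->
      \val (direction (sect_val e y)) * (sect_val xi y)^*.
    apply: (@quotient_cvg _ _ _ (fun x => base_eval x (gauge_dot xi e))
      (fun x => `|sect_val e x|)).
    + exact: base_eval_continuous.
    + apply: cvg_sqr => [z //||]; first by rewrite normr_eq0; exact/nonvanishingP.
      have sq z : `|sect_val e z| ^+ 2 = base_eval z (gauge_dot e e).
        by rewrite normCK mulrC sect_val_dot.
      rewrite sq; have -> : (fun z => `|sect_val e z| ^+ 2) =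
          (fun z => base_eval z (gauge_dot e e)) by apply/funext.
      exact: base_eval_continuous.
    + by rewrite normr_eq0; exact/nonvanishingP.
    + by move=> z; rewrite mulrAC direction_mul mulrC sect_val_dot.
  have g1 : (fun q : X * circle C =>
      \val (direction (sect_val e q.1)) * (sect_val xi q.1)^*) @ (y, w) -->
      \val (direction (sect_val e y)) * (sect_val xi y)^*.
    by apply: cvg_comp F_cvg; exact: cvg_fst.
  have g2 := ptcomp_continuous (@ptsnd_continuous X (circle C)) circle_val_continuous.
  have -> : (fun q : X * circle C =>
      circle_coord (circle_point q.1 (q.2 * direction (sect_val e q.1))%g) xi) =
    (fun q => \val q.2 * (\val (direction (sect_val e q.1)) * (sect_val xi q.1)^*)).
    by apply/funext => q; rewrite /circle_coord vec_circle_point circle_valM -mulrA.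
  rewrite /circle_coord vec_circle_point circle_valM -mulrA.
  exact: (cvgM (@g2 (y, w)) g1).
- by move=> p pe; split.
- by move=> [y w] [ye _].
- by move=> p /set_mem pe /=; rewrite direction_circle_coord // circle_pointK.
- move=> [y w] /set_mem [/= /nonvanishingP ye _]; congr (_, _).
  apply: (@mulIg _ (direction (sect_val e y))).
  have := @direction_circle_coord e (circle_point y (w * direction (sect_val e y))%g).
  by rewrite vec_circle_point => -> //; exact/nonvanishingP.
Qed.

Lemma gauge_principal :
  principal_circle_bundle proj (circle_bundle_act L).
Proof.
split.
- exact: proj_continuous.
- exact: act_continuous.
- by move=> p; rewrite -(circle_pointK p) act_circle_point mul1g.
- by split=> // z w p; rewrite -(circle_pointK p) !act_circle_point mulgA.
- exact: circle_bundle_trivial.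
Qed.

(** The unit vector v over x stands for the character v.p_x. *)
Definition point_char (p : P) : spectrum A :=
  rotate gamma (circle_vec p) (sect (proj p)).

Definition char_point (chi : spectrum A) : P :=
  circle_point (restr gamma chi) (phase Egen chi_le chi).

Lemma char_pointK chi : point_char (char_point chi) = chi.
Proof. by rewrite /point_char vec_circle_point rotate_phase. Qed.

Lemma point_charK p : char_point (point_char p) = p.
Proof.
rewrite /char_point phase_rotate phase_sect mulg1 restr_rotate restr_sect.
exact: circle_pointK.
Qed.

Lemma point_char_module p (xi : E) :
  chi_val (point_char p) (\val xi) = (\val (circle_vec p))^* * sect_val xi (proj p).
Proof. exact: rotate_module. Qed.

Lemma circle_coordE p xi : circle_coord p xi = (chi_val (point_char p) (\val xi))^*.
Proof. by rewrite point_char_module rmorphM /= conjCK. Qed.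

Lemma point_char_act z p :
  point_char (circle_bundle_act L z p) = rotate gamma z (point_char p).
Proof.
rewrite -(circle_pointK p) act_circle_point /point_char !vec_circle_point !proj_circle_point.
exact: rotateM.
Qed.

Lemma char_point_continuous : continuous char_point.
Proof.
move=> chi; apply: cvg_circle_bundle; first exact: restr_continuous.
move=> xi.
have -> : (fun psi => circle_coord (char_point psi) xi) =
    (fun psi => (chi_val psi (\val xi))^*).
  by apply/funext => psi; rewrite circle_coordE char_pointK.
rewrite circle_coordE char_pointK.
by apply: (ptconj_continuous (f := fun psi : spectrum A => chi_val psi (\val xi)));
  exact: chi_eval_continuous.
Qed.

(** The elements with continuous transform on the circle bundle form a
    C*-subalgebra, and for those of degree one the transforms are the conjugates
    of the coordinates, continuous by the choice of the topology. *)
Lemma point_char_continuous a : continuous (fun p => chi_val (point_char p) a).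
Proof.
apply: (generated_ind Egen (S := [set a | continuous (fun p => chi_val (point_char p) a)])).
  have cc p := chi_character (point_char p).
  split => /=.
  - have -> : (fun p => chi_val (point_char p) 0) = (fun=> 0).
      by apply/funext => p; rewrite (character0 (cc p)).
    exact: ptcst_continuous.
  - move=> k b c hb hc.
    have -> : (fun p => chi_val (point_char p) (k *: b + c)) =
      (fun p => k * chi_val (point_char p) b + chi_val (point_char p) c).
      by apply/funext => p; rewrite (character_lin (cc p)).
    apply: ptadd_continuous => //; apply: ptmul_continuous => //.
    exact: ptcst_continuous.
  - move=> b c hb hc.
    have -> : (fun p => chi_val (point_char p) (amul b c)) =
      (fun p => chi_val (point_char p) b * chi_val (point_char p) c).
      by apply/funext => p; rewrite (characterM (cc p)).
    exact: ptmul_continuous.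
  - move=> b hb.
    have -> : (fun p => chi_val (point_char p) (star b)) =
      (fun p => (chi_val (point_char p) b)^*).
      by apply/funext => p; rewrite (character_star (cc p)).
    exact: ptconj_continuous.
  - move=> b clb.
    apply: (@approx_continuous _ _ (fun p => chi_val (point_char p) b)) => e e0.
    have bid : (fun c : A => c) @ b --> b by exact: cvg_id.
    have nb : nbhs b [set c | `|b - c| < e] by move/cvgrPdist_lt : bid; exact.
    have [c [/= hc bc]] := clb _ nb.
    exists (fun p => chi_val (point_char p) c); first by [].
    by move=> p; rewrite -(characterB (cc p)); apply: le_lt_trans bc; exact: chi_le.
move=> xi /=.
have -> : (fun p => chi_val (point_char p) (\val xi)) = (fun p => (circle_coord p xi)^*).
  by apply/funext => p; rewrite circle_coordE conjCK.
exact: (ptconj_continuous (@circle_coord_continuous xi)).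
Qed.

End CircleBundle.

Arguments point_char_continuous {C A gamma} Egen chi_le a.

(** * The isomorphisms *)
Section Assembly.
Variables (C : numClosedFieldType) (A : comCStarAlgType C).
Variable gamma : circle_action A.
Hypothesis Egen : cstar_generated (spectral_subspace gamma 1) = [set: A].
Hypothesis chi_le : forall (chi : spectrum A) a, `|chi_val chi a| <= `|a|.
Hypothesis gelfand_inj : forall a : A, (forall chi, chi_val chi a = 0) -> a = 0.
Hypothesis gelfand_surj : forall f : spectrum A -> C, continuous f ->
  exists a, forall chi, f chi = chi_val chi a.
Local Notation X := (base_space gamma).
Local Notation E := (gauge_module gamma).
Local Notation B := (gauge_base gamma).
Local Notation L := (gauge_hermitian Egen chi_le).
Local Notation P := (circle_bundle L).
Local Notation proj := (@circle_bundle_proj C X L).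
Local Notation point_char := (@point_char C A gamma Egen chi_le).
Local Notation char_point := (@char_point C A gamma Egen chi_le).
Local Notation phase := (phase Egen chi_le).

Lemma gelfand_eq (a b : A) : (forall chi, chi_val chi a = chi_val chi b) -> a = b.
Proof.
move=> ab; apply: subr0_eq; apply: gelfand_inj => chi.
by rewrite (characterB (chi_character chi)) ab subrr.
Qed.

Definition gauge_phi (b : B) : cfun C X := mk_cfun (base_eval_continuous b).

Lemma gauge_phiE b x : gauge_phi b x = chi_val (sect x) (\val b).
Proof. by rewrite sect_base. Qed.

(** A continuous function on X pulls back to an invariant function on the spectrum,
    and an element with invariant transform is fixed by the circle. *)
Lemma gauge_phi_iso : star_isomorphism gauge_phi.
Proof.
have cc (x : X) := chi_character (sect x).
split.
- apply: inj_surj_bijective => [b c bc|f].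
    apply: val_inj; apply: gelfand_eq => chi.
    by have := congr1 (fun f : cfun C X => f (restr gamma chi)) bc.
  have [|a fa] := gelfand_surj (f := fun chi => f (restr gamma chi)).
    apply: ptcomp_continuous; [exact: restr_continuous|exact: cfun_continuous].
  have a0 : spectral_subspace gamma 0 a.
    move=> z; rewrite expr0z scale1r; apply: gelfand_eq => chi.
    by rewrite -[z]invgK -rotateE -!fa restr_rotate.
  exists (mk_base a0); apply: cfunP => x.
  by rewrite gauge_phiE -fa restr_sect.
- move=> k b c; apply: cfunP => x.
  transitivity (k * gauge_phi b x + gauge_phi c x) => //.
  by rewrite !gauge_phiE; exact: (character_lin (cc x)).
- by apply: cfunP => x; rewrite gauge_phiE; exact: (character1 (cc x)).
- move=> b c; apply: cfunP => x.
  transitivity (gauge_phi b x * gauge_phi c x) => //.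
  by rewrite !gauge_phiE; exact: (characterM (cc x)).
- move=> b; apply: cfunP => x.
  transitivity ((gauge_phi b x)^*) => //.
  by rewrite !gauge_phiE; exact: (character_star (cc x)).
Qed.

Definition gauge_Phi (a : A) : cfun C P :=
  mk_cfun (point_char_continuous Egen chi_le a).

Lemma gauge_PhiE a p : gauge_Phi a p = chi_val (point_char p) a.
Proof. by []. Qed.

Lemma gauge_Phi_iso : star_isomorphism gauge_Phi.
Proof.
have cc (p : P) := chi_character (point_char p).
split.
- apply: inj_surj_bijective => [a b ab|f].
    apply: gelfand_eq => chi; rewrite -(char_pointK Egen chi_le chi).
    by have := congr1 (fun f : cfun C P => f (char_point chi)) ab.
  have [|a fa] := gelfand_surj (f := fun chi => f (char_point chi)).
    apply: ptcomp_continuous; [exact: char_point_continuous|exact: cfun_continuous].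
  by exists a; apply: cfunP => p; rewrite gauge_PhiE -fa point_charK.
- by move=> k a b; apply: cfunP => p; exact: (character_lin (cc p)).
- by apply: cfunP => p; exact: (character1 (cc p)).
- by move=> a b; apply: cfunP => p; exact: (characterM (cc p)).
- by move=> a; apply: cfunP => p; exact: (character_star (cc p)).
Qed.

Lemma gauge_Phi_gamma z a p :
  gauge_Phi (gamma z a) p = gauge_Phi a (circle_bundle_act L z^-1%g p).
Proof. by rewrite !gauge_PhiE point_char_act rotateE invgK. Qed.

Lemma gauge_Phi_base b p : gauge_Phi (\val b) p = gauge_phi b (proj p).
Proof. by rewrite gauge_PhiE gauge_phiE; exact: rotate_base. Qed.

Definition gauge_sigma (xi : E) (x : X) : fiber L x := sect_val xi x : C^o.

Lemma gauge_sigma_continuous xi : continuous_sections L (gauge_sigma xi).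
Proof.
move=> x; apply: (@cvg_total _ _ gamma X (fun x => total_pt (gauge_sigma xi x))).
  exact: cvg_id.
move=> eta.
have e y : @line_coord _ _ gamma (@total_pt _ _ L y (gauge_sigma xi y)) eta =
    base_eval y (gauge_dot eta xi).
  by rewrite -sect_val_dot mulrC.
have -> : (fun y => @line_coord _ _ gamma (@total_pt _ _ L y (gauge_sigma xi y)) eta) =
  (fun y => base_eval y (gauge_dot eta xi)) by apply/funext.
rewrite e; exact: base_eval_continuous.
Qed.

(** The scalar product with a section, as a function on unit vectors, transported to
    the spectrum. *)
Lemma section_functional_continuous (s : forall x, fiber L x) :
  continuous_sections L s ->
  continuous (fun chi => (\val (phase chi))^* * (s (restr gamma chi) : C)).
Proof.
move=> cs chi; have [e ce] := module_nonzero Egen chi_le chi.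
have cs' : continuous (fun x => @line_coord _ _ gamma (@total_pt _ _ L x (s x)) e).
  exact: (ptcomp_continuous cs (@line_coord_continuous _ _ gamma e)).
have c1 := ptcomp_continuous (@restr_continuous _ _ gamma) cs'.
have c2 := ptmul_continuous (chi_eval_continuous (\val e)) c1.
apply: (@quotient_cvg _ _ _ (fun psi => chi_val psi (\val e) *
   @line_coord _ _ gamma (@total_pt _ _ L _ (s (restr gamma psi))) e)
   (fun psi => chi_val psi (\val (gauge_dot e e)))).
- exact: c2.
- exact: chi_eval_continuous.
- by rewrite chi_dot mulf_neq0 ?conjC_eq0.
- move=> psi; rewrite chi_dot {1}(phase_module Egen chi_le) rmorphM /= conjCK.
  rewrite /line_coord /= /sect_val.
  have := circle_conjM (phase psi); rewrite /=.
  set u := sval (phase psi) => pp; set v := chi_val (sect _) _; set w := chi_val psi _.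
  transitivity (u^* * u * (s (restr gamma psi) : C) * v^* * w); first by ring.
  by rewrite pp; ring.
Qed.

(** A continuous section gives an equivariant function of degree one on the spectrum,
    which is the transform of an element of degree one. *)
Lemma gauge_sigma_bij :
  set_bij [set: E] (continuous_sections L) gauge_sigma.
Proof.
split.
- by move=> xi _; exact: gauge_sigma_continuous.
- move=> xi eta _ _ E12; apply: val_inj; apply: gelfand_eq => chi.
  rewrite !(phase_module Egen chi_le chi); congr (_ * _).
  exact: (congr1 (fun s : forall x, fiber L x => s (restr gamma chi) : C) E12).
- move=> s cs.
  have [a fa] := gelfand_surj (section_functional_continuous cs).
  have a1 : spectral_subspace gamma 1 a.
    move=> z; rewrite expr1z; apply: gelfand_eq => chi.
    rewrite (characterZ (chi_character chi)) -{1}[z]invgK -rotateE -!fa.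
    rewrite restr_rotate phase_rotate circle_valM circle_val_inv rmorphM /= conjCK.
    by rewrite mulrA.
  exists (mk_module a1) => //; apply: functional_extensionality_dep => x.
  rewrite /gauge_sigma /sect_val -fa phase_sect restr_sect.
  by rewrite rmorph1 mul1r.
Qed.

End Assembly.

Local Open Scope complex_scope.

Theorem proposition5p8 (R : realType) (A : comCStarAlgType R[i])
    (gamma : circle_action A)
    (Egen : cstar_generated (spectral_subspace gamma 1) = [set: A])
    (Efg : finitely_generated (gauge_module gamma))
    (Eproj : projective (gauge_module gamma)) :
  exists (X : topologicalType) (L : hermitian_line_bundle R[i] X)
    (phi : gauge_base gamma -> cfun R[i] X)
    (sigma : gauge_module gamma -> forall x : X, fiber L x)
    (Phi : A -> cfun R[i] (circle_bundle L)),
  [/\ compact [set: X], hausdorff_space X & star_isomorphism phi] /\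
  [/\ set_bij [set: gauge_module gamma] (continuous_sections L) sigma,
      forall xi eta x, sigma (xi + eta) x = sigma xi x + sigma eta x,
      forall b xi x, sigma (b *: xi) x = phi b x *: sigma xi x
    & forall xi eta x,
        phi (gauge_dot xi eta) x = hdot (sigma xi x) (sigma eta x)] /\
  [/\ principal_circle_bundle (circle_bundle_proj L)
        (circle_bundle_act L),
      star_isomorphism Phi,
      forall z a p, Phi (gamma z a) p = Phi a (circle_bundle_act L z^-1%g p),
      forall b p, Phi (\val b) p = phi b (circle_bundle_proj L p)
    & forall xi p, Phi (\val xi) p =
        hdot (circle_bundle_vec p) (sigma xi (circle_bundle_proj L p))].
Proof.
have chi_le (chi : spectrum A) a : `|chi_val chi a| <= `|a|.
  by rewrite !rnormE lecR; apply: character_le; exact: chi_character.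
have ginj := @gelfand_injective R A; have gsurj := @gelfand_surjective R A.
exists (base_space gamma), (gauge_hermitian Egen chi_le), (@gauge_phi _ _ gamma),
  (gauge_sigma Egen chi_le), (gauge_Phi Egen chi_le).
split; [split|split; split].
- exact/base_space_compact/spectrum_compact.
- exact: base_space_hausdorff.
- exact: gauge_phi_iso.
- exact: gauge_sigma_bij.
- by move=> xi eta x; exact: (characterD (chi_character _)).
- move=> b xi x; rewrite gauge_phiE; exact: (characterM (chi_character _)).
- by move=> xi eta x; rewrite gauge_phiE; exact: chi_dot.
- exact: gauge_principal.
- exact: gauge_Phi_iso.
- exact: gauge_Phi_gamma.
- exact: gauge_Phi_base.
- by move=> xi p; rewrite gauge_PhiE point_char_module.
Qed.
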